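(* Let $0<\alpha<1$ be an arbitrary constant. Then any QMA query protocol for $\operatorname{PTP}_{n,\alpha}$ with witness length $m$ has query cost $\Omega\left((n/m)^{1/3}\right)$. In particular, $\operatorname{PTP}_{n,\alpha}$ has QMA query complexity $\Omega(n^{1/4})$.
   Context: Let $\mathcal{D}_{n,n}$ denote the set of Boolean $n\times n$ matrices in which every row contains exactly one $1$. For $0<\alpha<1$, the permutation testing function $\operatorname{PTP}_{n,\alpha}$ is defined on the set of $x\in\mathcal{D}_{n,n}$ for which the number of columns containing a $1$ is either exactly $n$ or at most $\alpha n$; it is $1$ in the former case (x is a permutation matrix) and $0$ in the latter. A QMA query protocol for a function $f\colon X\to\{0,1\}$, $X\subseteq\{0,1\}^N$, with witness length $m$ and query cost $q$, consists of a quantum query algorithm (Arthur) that receives an arbitrary $m$-qubit quantum state (the witness, supplied by Merlin, who knows the input $x$), makes at most $q$ quantum queries to the bits of $x$, and accepts or rejects, such that: for every $x\in f^{-1}(1)$ there is a witness causing acceptance with probability at least $2/3$, and for every $x\in f^{-1}(0)$ every witness causes acceptance with probability at most $1/3$. Here the input bits are the entries $x_{i,j}$ of the matrix. The QMA query complexity of $f$ is the minimum of $m+q$ over all such protocols. *)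

(* Defs.v *)
From HB Require Import structures.
From mathcomp Require Import all_boot all_order all_algebra.
From mathcomp Require Import spectral.
From mathcomp Require Import all_classical all_reals all_analysis.
From mathcomp Require Import complex.

Set Implicit Arguments.
Unset Strict Implicit.
Unset Printing Implicit Defensive.

Import Order.TTheory GRing.Theory Num.Theory.
Local Open Scope ring_scope.

(* A partial Boolean function on bit strings indexed by I; None means that the
   input is outside the domain. *)
Definition partial_fun (I : finType) := {ffun I -> bool} -> option bool.

(* Computational basis: query address, answer qubit, m-qubit witness register,
   a-qubit ancilla register. The address None is the null query. *)
Definition qbasis (I : finType) (m a : nat) : finType :=
  (option I * bool * 'I_(2 ^ m) * 'I_(2 ^ a))%type.

Definition qdim (I : finType) (m a : nat) : nat := #|{: qbasis I m a}|.

(* O_x |i, b, w, z> = |i, b (+) x_i, w, z>, and O_x |None, b, w, z> =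
   |None, b, w, z>. *)
Definition oracle_act (I : finType) (m a : nat) (x : {ffun I -> bool})
    (s : qbasis I m a) : qbasis I m a :=
  let: (i, b, w, z) := s in
  (i, b (+) (if i is Some j then x j else false), w, z).

Definition oracle_mx (R : realType) (I : finType) (m a : nat)
    (x : {ffun I -> bool}) : 'M[R[i]]_(qdim I m a) :=
  \matrix_(k, l) (enum_val k == oracle_act x (enum_val l))%:R.

(* The algorithm applies alg_first, and then, for each U in alg_rest, one query
   followed by U. At the end the basis state is measured, and the algorithm
   accepts if the outcome is in alg_accept. *)
Record query_algorithm (R : realType) (I : finType) (m : nat) :=
  QueryAlgorithm {
    alg_ancilla : nat;
    alg_first : 'M[R[i]]_(qdim I m alg_ancilla);
    alg_rest : seq 'M[R[i]]_(qdim I m alg_ancilla);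
    alg_accept : {set qbasis I m alg_ancilla};
    alg_first_unitary : alg_first \is unitarymx;
    alg_rest_unitary : forall U, U \in alg_rest -> U \is unitarymx }.

Definition num_queries (R : realType) (I : finType) (m : nat)
    (A : query_algorithm R I m) : nat := size (alg_rest A).

Definition sqmod (R : realType) (z : R[i]) : R :=
  complex.Re z ^+ 2 + complex.Im z ^+ 2.

Definition is_qstate (R : realType) (d : nat) (psi : 'cV[R[i]]_d) : Prop :=
  \sum_k sqmod (psi k 0) = 1.

(* |None> |0> (x) w (x) |0^a> *)
Definition initial_state (R : realType) (I : finType) (m a : nat)
    (w : 'cV[R[i]]_(2 ^ m)) : 'cV[R[i]]_(qdim I m a) :=
  \col_k let: (i, b, u, z) := (enum_val k : qbasis I m a) in
         if [&& i == None, ~~ b & (z == 0%N :> nat)] then w u 0 else 0.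

Definition final_state (R : realType) (I : finType) (m : nat)
    (A : query_algorithm R I m) (x : {ffun I -> bool})
    (w : 'cV[R[i]]_(2 ^ m)) : 'cV[R[i]]_(qdim I m (alg_ancilla A)) :=
  foldl (fun psi U => U *m (oracle_mx R m (alg_ancilla A) x *m psi))
        (alg_first A *m initial_state I (alg_ancilla A) w)
        (alg_rest A).

Definition accept_prob (R : realType) (I : finType) (m : nat)
    (A : query_algorithm R I m) (x : {ffun I -> bool})
    (w : 'cV[R[i]]_(2 ^ m)) : R :=
  \sum_(s in alg_accept A) sqmod (final_state A x w (enum_rank s) 0).

Definition QMA_computes (R : realType) (I : finType) (m : nat)
    (A : query_algorithm R I m) (f : partial_fun I) : Prop :=
  (forall x, f x = Some true ->
     exists2 w, is_qstate w & 2%:R / 3%:R <= accept_prob A x w) /\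
  (forall x, f x = Some false ->
     forall w, is_qstate w -> accept_prob A x w <= 1%:R / 3%:R).

Definition has_QMA_protocol (R : realType) (I : finType) (f : partial_fun I)
    (m q : nat) : Prop :=
  exists2 A : query_algorithm R I m,
    QMA_computes A f & (num_queries A <= q)%N.

(* The minimum of m + q over all protocols: an infimum of natural numbers,
   with the convention that it is +oo if there is no protocol. *)
Definition QMA_complexity (R : realType) (I : finType) (f : partial_fun I) :
    \bar R :=
  ereal_inf [set e : \bar R | exists m q : nat,
    has_QMA_protocol R f m q /\ e = ((m + q)%N%:R : R)%:E]%classic.

Definition one_per_row (n : nat) (x : {ffun 'I_n * 'I_n -> bool}) : bool :=
  [forall i, #|[set j | x (i, j)]| == 1%N].

Definition occupied_columns (n : nat) (x : {ffun 'I_n * 'I_n -> bool}) :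
    {set 'I_n} :=
  [set j | [exists i, x (i, j)]].

Definition PTP (R : realType) (n : nat) (alpha : R) :
    partial_fun ('I_n * 'I_n)%type :=
  fun x =>
    if ~~ one_per_row x then None
    else if #|occupied_columns x| == n then Some true
    else if #|occupied_columns x|%:R <= alpha * n%:R then Some false
    else None.
Arguments PTP {R} n alpha.

(* Main.v *)
Require Import Defs.
From mathcomp Require Import all_boot all_order all_fingroup all_algebra.
From mathcomp Require Import spectral.
From mathcomp Require Import all_classical all_reals all_analysis.
From mathcomp Require Import complex.
From mathcomp Require Import ring lra zify.
Set Implicit Arguments.
Unset Strict Implicit.
Unset Printing Implicit Defensive.
Import Order.TTheory GRing.Theory Num.Theory.
Local Open Scope ring_scope.

(* The acceptance probability of Arthur is a quadratic form [w^* M(x) w], where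
   [0 <= M(x) <= 1] is a [2^m x 2^m] matrix whose entries are polynomials of degree
   [2q] in [x].  For [k = O(m)] the polynomial [tr M(x)^k] is at least [(2/3)^k] on
   yes-instances and at most [2^m 3^-k] on no-instances, a gap of [2^(k-m)], and has
   degree [d <= 2qk].  Average it over [tau o h], where [tau] is a uniform
   permutation and [h] a uniform function with [N] values: the result is [Q(1/N)]
   for a univariate polynomial [Q] of degree at most [d] (Zhandry's small-range
   distributions), with [Q(0)] the average over permutations.  Thus [Q] is tiny at
   [1/N] for all [N <= alpha n], but not at [0].  Interpolating between the integers
   [N] shows that [Q] is tiny on the whole interval [[2/(alpha n), 1/(2d+3)]], and a
   polynomial of degree [d] grows from there to [0] by at most
   [exp(O(d sqrt(d/(alpha n))))].  Hence [m = O(sqrt(d^3/n))] with [d = O(qm)], that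
   is, [n = O(q^3 m)]. *)

(** * Lagrange interpolation at the integers *)

Lemma lagrange_interpolation (F : fieldType) (N : nat) (u : 'I_N -> F)
    (p : {poly F}) (x : F) :
  injective u -> (size p <= N)%N ->
  p.[x] = \sum_i p.[u i] * \prod_(j | j != i) ((x - u j) / (u i - u j)).
Proof.
move=> u_inj sp.
pose l i : {poly F} := \prod_(j | j != i) ((u i - u j)^-1 *: ('X - (u j)%:P)).
have lE i y : (l i).[y] = \prod_(j | j != i) ((y - u j) / (u i - u j)).
  rewrite horner_prod; apply: eq_bigr => j _.
  by rewrite hornerZ hornerXsubC mulrC.
have -> : p = \sum_i p.[u i] *: l i; last first.
  rewrite horner_sum; apply: eq_bigr => i _; rewrite hornerZ lE.
  congr (_ * _); rewrite horner_sum (bigD1 i) //= big1 ?addr0.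
    rewrite hornerZ lE big1 ?mulr1 // => j ji; rewrite divff // subr_eq0.
    by apply: contraNneq ji => /u_inj ->.
  move=> j ji; rewrite hornerZ lE (bigD1 i) 1?eq_sym //=.
  by rewrite subrr mul0r mul0r mulr0.
apply/eqP; rewrite -subr_eq0; apply/eqP.
apply: (@roots_geq_poly_eq0 _ _ [seq u i | i <- enum 'I_N]).
- apply/allP => _ /mapP[i _ ->]; rewrite rootE hornerD hornerN horner_sum.
  rewrite (bigD1 i) //= big1 ?addr0.
    rewrite hornerZ lE big1 ?mulr1 ?subrr // => j ji.
    by rewrite divff // subr_eq0; apply: contraNneq ji => /u_inj ->.
  move=> j ji; rewrite hornerZ lE (bigD1 i) 1?eq_sym //=.
  by rewrite subrr mul0r mul0r mulr0.
- by rewrite map_inj_uniq // enum_uniq.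
- rewrite size_map size_enum_ord (leq_trans (size_polyD _ _)) // geq_max sp.
  rewrite size_polyN (leq_trans (size_sum _ _ _)) //; apply/bigmax_leqP => i _.
  rewrite (leq_trans (size_scale_leq _ _)) // /l.
  rewrite scaler_prod (leq_trans (size_scale_leq _ _)) // -big_filter.
  rewrite size_prod_XsubC size_filter -(leq_add2r 1) addn1.
  have := cardC1 i; rewrite card_ord cardE /enum_mem size_filter => cE.
  have -> : count (fun j => j != i) (index_enum 'I_N) = N.-1.
    by rewrite -cE; apply: eq_count => j; rewrite !inE.
  by have := ltn_ord i; lia.
Qed.

(* The analogues of [sin((2j+1)t)/sin t] and [cos((2j+1)t)/cos t] as polynomials
   in [sin t]. *)
Fixpoint odd_sincos (R : comNzRingType) (j : nat) : {poly R} * {poly R} :=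
  if j is j'.+1 then
    let: (A, B) := odd_sincos R j' in
    (A * (1 - 2%:R *: 'X^2) + 2%:R *: ((1 - 'X^2) * B),
     B * (1 - 2%:R *: 'X^2) - 2%:R *: ('X^2 * A))
  else (1, 1).

Definition odd_sin (R : comNzRingType) j : {poly R} := (odd_sincos R j).1.
Definition odd_cos (R : comNzRingType) j : {poly R} := (odd_sincos R j).2.

Lemma odd_sinS (R : comNzRingType) j (y : R) :
  (odd_sin R j.+1).[y] = (odd_sin R j).[y] * (1 - 2%:R * y ^+ 2)
     + 2%:R * ((1 - y ^+ 2) * (odd_cos R j).[y]).
Proof.
by rewrite /odd_sin /odd_cos /=; case: odd_sincos => A B /=; rewrite !hornerE.
Qed.

Lemma odd_cosS (R : comNzRingType) j (y : R) :
  (odd_cos R j.+1).[y] = (odd_cos R j).[y] * (1 - 2%:R * y ^+ 2)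
     - 2%:R * (y ^+ 2 * (odd_sin R j).[y]).
Proof.
by rewrite /odd_sin /odd_cos /=; case: odd_sincos => A B /=; rewrite !hornerE.
Qed.

(** With [y = sin t] this is [sin^2 + cos^2 = 1] at the angle [(2j+1)t]. *)
Lemma odd_sincos_id (R : comNzRingType) j (y : R) :
  y ^+ 2 * (odd_sin R j).[y] ^+ 2 + (1 - y ^+ 2) * (odd_cos R j).[y] ^+ 2 = 1.
Proof.
elim: j => [|j IH]; first by rewrite /odd_sin /odd_cos /= hornerC; ring.
by rewrite odd_sinS odd_cosS -[RHS]IH; ring.
Qed.

Lemma size_odd_sincos (R : comNzRingType) j :
  (size (odd_sin R j) <= j.*2.+1)%N && (size (odd_cos R j) <= j.*2.+1)%N.
Proof.
elim: j => [|j /andP[]]; first by rewrite size_poly1.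
rewrite /odd_sin /odd_cos /=; case: odd_sincos => A B /= sA sB.
have s2 (p q : {poly R}) : (size p <= j.*2.+1)%N -> (size q <= 3)%N ->
    (size (p * q)%R <= j.+1.*2.+1)%N.
  by move=> sp sq; have := size_mul_leq p q; lia.
have s1 (c : R) : (size (1 - c *: 'X^2 : {poly R})%R <= 3)%N.
  rewrite (leq_trans (size_polyD _ _)) // geq_max size_poly1 size_polyN.
  by rewrite (leq_trans (size_scale_leq _ _)) ?size_polyXn.
have s11 : (size (1 - 'X^2 : {poly R})%R <= 3)%N by rewrite -['X^2]scale1r s1.
apply/andP; split; rewrite (leq_trans (size_polyD _ _)) // geq_max ?size_polyN;
  rewrite ?s2 //= (leq_trans (size_scale_leq _ _)) // mulrC s2 //.
by rewrite size_polyXn.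
Qed.

Lemma odd_sincos0 (R : comNzRingType) j :
  (odd_sin R j).[0] = j.*2.+1%:R /\ (odd_cos R j).[0] = 1.
Proof.
elim: j => [|j [IA IB]]; first by rewrite /odd_sin /odd_cos /= hornerC.
rewrite odd_sinS odd_cosS IA IB doubleS -addn2 natrD; split; ring.
Qed.

(** * Bounds on the damping polynomial *)

Section Damping.
Variables (R : realFieldType) (y : R).
Hypothesis y_le1 : y ^+ 2 <= 1.

Lemma odd_sin_mul_le1 j : `|y * (odd_sin R j).[y]| <= 1.
Proof.
rewrite -(@ler_pXn2r _ 2) ?nnegrE ?normr_ge0 // expr1n real_normK ?num_real //.
have := odd_sincos_id j y.
have : 0 <= (1 - y ^+ 2) * (odd_cos R j).[y] ^+ 2.
  by rewrite mulr_ge0 ?sqr_ge0 // subr_ge0.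
by rewrite exprMn; lra.
Qed.

(** Successive values of [sin((2j+1)t)/sin t] differ by [2 cos((2j+2)t)], hence by at most 2. *)
Lemma odd_sin_le j : `|(odd_sin R j).[y]| <= j.*2.+1%:R.
Proof.
elim: j => [|j IH]; first by rewrite /odd_sin /= hornerE normr1.
set A := (odd_sin R j).[y] in IH *; set B := (odd_cos R j).[y].
have -> : (odd_sin R j.+1).[y] = A + 2%:R * ((1 - y ^+ 2) * B - y ^+ 2 * A).
  by rewrite odd_sinS -/A -/B; ring.
have D_le1 : `|(1 - y ^+ 2) * B - y ^+ 2 * A| <= 1.
  rewrite -(@ler_pXn2r _ 2) ?nnegrE ?normr_ge0 // expr1n real_normK ?num_real //.
  have := odd_sincos_id j y; rewrite -/A -/B => e.
  (* Cauchy-Schwarz *)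
  rewrite -subr_ge0 -{1}e (_ : _ - _ = (1 - y ^+ 2) * y ^+ 2 * (A + B) ^+ 2).
    by rewrite mulr_ge0 ?sqr_ge0 // mulr_ge0 ?sqr_ge0 // subr_ge0.
  by ring.
rewrite (le_trans (ler_normD _ _)) //.
have -> : (j.+1.*2.+1 = j.*2.+1 + 2)%N by lia.
rewrite natrD.
by rewrite lerD // normrM normr_nat ler_piMr.
Qed.

End Damping.

(** The central binomial coefficient is the largest of row [K.*2]. *)
Lemma fact_sqr_le (K i : nat) : (i <= K.*2)%N -> (K`! * K`! <= i`! * (K.*2 - i)`!)%N.
Proof.
have le s : (s <= K)%N -> (K`! * K`! <= (K + s)`! * (K - s)`!)%N.
  elim: s => [|s IH] sK; first by rewrite addn0 subn0.
  rewrite (leq_trans (IH (ltnW sK))) // addnS factS.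
  have -> : (K - s = (K - s.+1).+1)%N by lia.
  by rewrite factS mulnCA -mulnA leq_mul2r; apply/orP; right; lia.
case: (leqP i K) => iK i2.
  rewrite [leqRHS]mulnC; have := le (K - i)%N (leq_subr _ _).
  have -> : (K + (K - i) = K.*2 - i)%N by lia.
  by rewrite subKn //.
have := le (i - K)%N; have -> : (K + (i - K) = i)%N by lia.
have -> : (K - (i - K) = K.*2 - i)%N by lia.
by apply; lia.
Qed.

Lemma prod_dist_nat (R : realDomainType) (n : nat) (i : 'I_n.+1) :
  \prod_(l < n.+1 | l != i) `|i%:R - l%:R : R| = (i`! * (n - i)`!)%:R.
Proof.
rewrite -(big_mkord (fun l => l != i :> nat) (fun l => `|i%:R - l%:R : R|)).
have i_n : (i <= n)%N by rewrite -ltnS.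
rewrite (@big_cat_nat _ _ _ i.+1) //= big_mkcond big_nat_recr //= eqxx mulr1.
rewrite -big_mkcond /= natrM; congr (_ * _).
  rewrite big_nat_cond (eq_bigl (fun l => (0 <= l < i)%N)); last by move=> l; lia.
  rewrite -big_nat; elim: (i : nat) => [|k IH]; first by rewrite big_geq.
  rewrite big_nat_recl //= factS natrM -IH subr0 normr_nat; congr (_ * _).
  by apply: eq_bigr => l _; rewrite -!natr1; congr `|_|; ring.
rewrite big_nat_cond (eq_bigl (fun l => (i.+1 <= l < n.+1)%N)); last first.
  by move=> l; lia.
rewrite -big_nat -{1}[i.+1]addn1 addnC -[in X in \prod_(_ <= _ < X) _](subnK i_n).
rewrite -addSn big_addn addnK.
elim: (n - i)%N => [|k IH]; first by rewrite big_geq.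
rewrite big_nat_recr //= factS natrM IH mulrC; congr (_ * _).
by rewrite natrD opprD addrCA subrr addr0 normrN normr_nat.
Qed.

(** The nodes [k] and [-k] pair up, [|(th - k)(th + k)| = k^2 - th^2 <= k^2], and the node 0 leaves
    the factor [|th|]. *)
Lemma prod_dist_center_le (R : realFieldType) (K : nat) (th : R) :
  `|th| <= 2^-1 ->
  \prod_(l < K.*2.+1) `|th - (l%:R - K%:R)| <= `|th| * (K`! * K`!)%:R.
Proof.
move=> th_le; elim: K => [|K IH].
  by rewrite double0 big_ord_recl big_ord0 subrr subr0 fact0 muln1.
rewrite doubleS big_ord_recl big_ord_recr /= mulrCA.
have -> : (K.+1`! * K.+1`! = (K`! * K`!) * (K.+1 * K.+1))%N.
  by rewrite factS mulnACA mulnC.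
rewrite natrM [leRHS]mulrA ler_pM ?prodr_ge0 ?mulr_ge0 //.
  rewrite (le_trans _ IH) // le_eqVlt; apply/orP; left; apply/eqP.
  apply: eq_bigr => l _; congr `|_|; rewrite /bump /= natrD -natr1; ring.
rewrite -normrM /bump /= natrD -[K.*2.+1]addn1 natrD -mul2n !natrM -natr1.
rewrite (_ : _ * _ = th ^+ 2 - (K%:R + 1) ^+ 2); last by ring.
have : 0 <= K%:R :> R by []. move: (K%:R) => k k0.
move: th_le; rewrite ler_norml => /andP[? ?].
rewrite ler_norml; apply/andP; split; nra.
Qed.

Lemma center_weight_sum_le (R : realFieldType) (K : nat) :
  \sum_(i < K.*2.+1) (if i == K :> nat then 1 else 4%:R / (i%:R - K%:R : R) ^+ 2)
    <= 17%:R.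
Proof.
(* Strengthened for the induction: with [k = K+1], the two new terms sum to [8/k^2], which is below
   the telescoping [8/(k-1/2) - 8/(k+1/2)]. *)
have: \sum_(i < K.*2.+1) (if i == K :> nat then 1 else 4%:R / (i%:R - K%:R : R) ^+ 2)
    <= 17%:R - 8%:R / (K%:R + 2^-1).
  elim: K => [|K IH].
    by rewrite double0 big_ord_recl big_ord0 /= addr0 add0r invrK; lra.
  rewrite doubleS big_ord_recl big_ord_recr /= /bump /=.
  have -> : (1 + K.*2.+1 == K.+1)%N = false by lia.
  move: IH; set S := (X in X <= _ -> _); set S' := (X in _ + (X + _)).
  have -> : S' = S.
    apply: eq_bigr => i _; rewrite /= add1n eqSS; case: ifP => // _.
    by congr (_ / _ ^+ 2); rewrite -!natr1; ring.
  move=> IH.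
  rewrite sub0r add1n sqrrN (_ : _ - _ = K.+1%:R); last first.
    by rewrite -mul2n -!natr1 natrM; ring.
  have : 1 <= K.+1%:R :> R by rewrite ler1n.
  have eK : K%:R + 2^-1 = K.+1%:R - 2^-1 :> R by rewrite -natr1; field.
  move: IH; rewrite eK; move: (K.+1%:R) => k Sk k1.
  have : 8%:R / k ^+ 2 <= 8%:R / (k ^+ 2 - 4^-1).
    by rewrite ler_pM2l // lef_pV2 ?posrE; nra.
  have -> : 8%:R / (k ^+ 2 - 4^-1) = 8%:R / (k - 2^-1) - 8%:R / (k + 2^-1).
    by field; apply/andP; split; nra.
  lra.
have : 0 <= 8%:R / (K%:R + 2^-1) :> R by rewrite divr_ge0 // addr_ge0 // invr_ge0.
lra.
Qed.

(* Interpolation at all the integers of [[-K, K]] has a Lebesgue constant of order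
   [log K] near [0]; damping [p] by [odd_sin] brings it down to a constant. *)
Lemma center_interpolation_le (R : realFieldType) (K : nat) (th M : R)
    (p : {poly R}) :
  (0 < K)%N -> `|th| <= 2^-1 -> (size p <= K.+1)%N ->
  (forall i : 'I_K.*2.+1, `|p.[i%:R - K%:R]| <= M) ->
  `|p.[th]| <= 17%:R * M.
Proof.
move=> K_gt0 th_le sp pM.
have M_ge0 : 0 <= M by apply: le_trans (pM ord0).
(* At [th = 0] the bound is one of the hypotheses; otherwise [|th|] can be cancelled at the central
   node. *)
have [->|th_neq0] := eqVneq th 0.
  have Kl : (K < K.*2.+1)%N by lia.
  have := pM (Ordinal Kl); rewrite /= subrr => /le_trans; apply; lra.
have K0 : 0 < K%:R :> R by rewrite ltr0n.
(* [2j <= K] keeps the degree of [p * T] at most [2K], while [2j+1 >= K] makes the value [2j+1] of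
   [T] at [th] large enough. *)
have [j [Kj jK]] : exists j, (K <= j.*2.+1 /\ j.*2 <= K)%N.
  by exists K./2; have := odd_double_half K; case: (odd K) => /=; lia.
(* The scaling gives [|y| <= 1] at every node, and [y th = 0], where the damping polynomial
   peaks. *)
pose y x := (x - th) / (2%:R * K%:R).
pose T : {poly R} := odd_sin R j \Po ((2%:R * K%:R)^-1 *: ('X - th%:P)).
have TE x : T.[x] = (odd_sin R j).[y x].
  by rewrite horner_comp hornerZ hornerXsubC /y mulrC.
pose u (i : 'I_K.*2.+1) : R := i%:R - K%:R.
have u_inj : injective u.
  by move=> i i' /addIr /eqP; rewrite eqr_nat => /eqP/val_inj.
have sT : (size T <= j.*2.+1)%N.
  rewrite (leq_trans (size_comp_poly_leq _ _)) //.
  have /andP[s1 _] := size_odd_sincos R j.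
  have : (size ((2%:R * K%:R)^-1 *: ('X - th%:P) : {poly R}) <= 2)%N.
    by rewrite (leq_trans (size_scale_leq _ _)) // size_XsubC.
  by move: (size _) (size _) s1 => a b; nia.
have spT : (size (p * T)%R <= K.*2.+1)%N.
  by rewrite (leq_trans (size_mul_leq _ _)) //; lia.
have j_gt0 : 0 < j.*2.+1%:R :> R by rewrite ltr0n.
have f_gt0 : 0 < (K`! * K`!)%:R :> R by rewrite ltr0n muln_gt0 fact_gt0.
have y_le1 i : y (u i) ^+ 2 <= 1.
  rewrite -(expr1n _ 2) -[y _ ^+ 2]real_normK ?num_real // ler_pXn2r ?nnegrE //.
  have k1 : 1 <= K%:R :> R by rewrite ler1n.
  rewrite /y normrM [`|_^-1|]ger0_norm ?invr_ge0; last by lra.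
  rewrite ler_pdivrMr; last by lra.
  have ui : `|u i| <= K%:R.
    have : i%:R <= 2%:R * K%:R :> R.
      by rewrite -natrM ler_nat mul2n -ltnS.
    have : 0 <= i%:R :> R by [].
    by rewrite ler_norml /u => ? ?; apply/andP; split; lra.
  by rewrite (le_trans (ler_normB _ _)) //; lra.
pose W i := `|\prod_(l | l != i) ((th - u l) / (u i - u l))|.
have W_ge0 i : 0 <= W i by exact: normr_ge0.
have W_le i : W i * `|th - u i| <= `|th|.
  rewrite /W normr_prod (eq_bigr (fun l => `|th - u l| / `|u i - u l|)); last first.
    by move=> l _; rewrite normf_div.
  rewrite prodf_div mulrAC.
  rewrite (eq_bigr (fun l : 'I_K.*2.+1 => `|i%:R - l%:R|) (P := fun l => l != i)
    (F1 := fun l => `|u i - u l|)); last first.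
    by move=> l _; congr `|_|; rewrite /u; ring.
  rewrite prod_dist_nat mulrC.
  have d_gt0 : 0 < (i`! * (K.*2 - i)`!)%:R :> R.
    by rewrite ltr0n muln_gt0 !fact_gt0.
  rewrite mulrC ler_pdivrMr // mulrC.
  have -> : `|th - u i| * \prod_(l | l != i) `|th - u l| = \prod_l `|th - u l|.
    by rewrite [RHS](bigD1 i).
  rewrite (le_trans (prod_dist_center_le _ th_le)) // ler_wpM2l // ler_nat.
  by rewrite fact_sqr_le // -ltnS.
(* Away from the centre, with [s = u i], the damping factor is at most [2K/|th - s|] and the weight
   at most [1/(2|th - s|)], where [|th - s| >= |s|/2] since [|s| >= 1]. *)
have key i : `|(odd_sin R j).[y (u i)]| * W i <=
   (if i == K :> nat then 1 else 4%:R / (i%:R - K%:R) ^+ 2) * j.*2.+1%:R.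
  case: ifPn => [/eqP iK|iK].
    rewrite mul1r -[leRHS]mulr1 ler_pM ?odd_sin_le ?W_ge0 //.
    have := W_le i; have -> : u i = 0 by rewrite /u iK subrr.
    rewrite subr0 -ler_pdivlMr ?normr_gt0 //.
    by rewrite divff ?normr_eq0.
  have s1 : 1 <= `|u i|.
    rewrite /u; case: (ltngtP (i : nat) K) iK => // iK _.
      rewrite distrC -natrB ?(ltnW iK) // normr_nat ler1n; lia.
    rewrite -natrB ?(ltnW iK) // normr_nat ler1n; lia.
  rewrite -/(u i); set s := u i in s1 *; set o := _.[_].
  have sth : `|s| <= `|th - s| + `|th|.
    by have := ler_normD (s - th) th; rewrite subrK (distrC s).
  set dl := `|th - s| in sth *.
  have dl_ge : `|s| / 2%:R <= dl by lra.
  have dl_gt0 : 0 < dl by lra.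
  have o_le : `|o| <= 2%:R * K%:R / dl.
    have := odd_sin_mul_le1 (y_le1 i) j; rewrite -/s -/o normrM /y normf_div.
    rewrite (distrC s) -/dl [`|2%:R * _|]ger0_norm; last by lra.
    by rewrite mulrAC ler_pdivrMr ?mul1r; [rewrite ler_pdivlMr // mulrC|lra].
  have w_le : W i <= 2^-1 / dl.
    rewrite ler_pdivlMr //; apply: le_trans th_le; exact: W_le.
  apply: le_trans (_ : (2%:R * K%:R / dl) * (2^-1 / dl) <= _).
    by rewrite ler_pM ?W_ge0.
  rewrite (_ : _ * _ = (K%:R / dl ^+ 2)); last by field; lra.
  rewrite -[s ^+ 2]real_normK ?num_real // ler_pdivrMr ?exprn_gt0 //.
  rewrite mulrAC [X in _ <= X * _]mulrAC [leRHS]mulrAC ler_pdivlMr; last first.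
    by rewrite exprn_gt0; lra.
  rewrite [leRHS]mulrC ler_pM ?mulr_ge0 ?sqr_ge0 ?ler_nat //.
  have -> : 4%:R * dl ^+ 2 = (2%:R * dl) ^+ 2 by ring.
  by rewrite ler_pXn2r ?nnegrE //; lra.
(* Interpolating [p * T] at [th] yields [(2j+1) p(th)], so the factor [2j+1] of [key] cancels. *)
have := lagrange_interpolation th u_inj spT.
rewrite hornerM TE /y subrr mul0r (odd_sincos0 R j).1 => pE.
rewrite -(ler_pM2r j_gt0) -{1}[_%:R]normr_nat -normrM pE.
rewrite (le_trans (ler_norm_sum _ _ _)) //.
apply: le_trans (_ : \sum_(i < K.*2.+1)
   (if i == K :> nat then 1 else 4%:R / (i%:R - K%:R : R) ^+ 2) * (M * j.*2.+1%:R) <= _).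
  apply: ler_sum => i _; rewrite hornerM normrM normrM TE -mulrA.
  by rewrite [leRHS]mulrCA ler_pM ?pM ?mulr_ge0 ?W_ge0 // key.
rewrite -mulr_suml -mulrA ler_wpM2r ?mulr_ge0 //.
exact: center_weight_sum_le.
Qed.

(** * Extrapolation from the reciprocals of integers *)

Lemma bernoulli_le (R : realDomainType) (x : R) (d : nat) :
  0 <= x <= 1 -> 1 - d%:R * x <= (1 - x) ^+ d.
Proof.
move=> /andP[x0 x1]; elim: d => [|d IH]; first by rewrite expr0; lra.
rewrite exprS -natr1; apply: le_trans (_ : (1 - x) * (1 - d%:R * x) <= _).
  have : 0 <= d%:R :> R by [].
  move: (d%:R : R) => k; nra.
by rewrite ler_wpM2l // subr_ge0.
Qed.

(** Reversal moves the nodes [1/N] to the integers [N]. *)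
Lemma horner_reverse (F : fieldType) (d : nat) (Q : {poly F}) (x : F) :
  (size Q <= d.+1)%N -> x != 0 ->
  (\poly_(k < d.+1) Q`_(d - k)).[x] = x ^+ d * Q.[x^-1].
Proof.
move=> sQ x0; rewrite horner_poly (horner_coef_wide _ sQ) mulr_sumr.
rewrite (reindex_inj rev_ord_inj); apply: eq_bigr => k _ /=.
have kd : (k <= d)%N by rewrite -ltnS.
rewrite subSS subKn // exprVn mulrCA -expfB_cond ?(negPf x0) //=.
Qed.

(** Reversal alone brings in a factor [x^d] that varies too much over the nodes. A mirror factor
    about the integer [c] nearest to [s] turns it into [(c^2 - x^2)^d Q(1/(c+x))], whose prefactor
    is largest at the centre, so only a constant is lost. *)
Lemma bounded_between_integers (R : realType) (d n : nat) (Q : {poly R})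
    (eps s : R) :
  (size Q <= d.+1)%N ->
  (forall N : nat, (0 < N <= n)%N -> `|Q.[N%:R^-1]| <= eps) ->
  (d.*2 + 3)%N%:R <= s -> 2%:R * s <= n%:R ->
  `|Q.[s^-1]| <= 34%:R * eps.
Proof.
move=> sQ Q_le ds sn.
have s_ge0 : 0 <= s by apply: le_trans ds.
have [c [c1 c2]] : exists c : nat, c%:R <= s + 2^-1 /\ s + 2^-1 < c%:R + 1.
  exists (Num.truncn (s + 2^-1)); apply/andP.
  by rewrite natr1 truncn_itv //; lra.
pose th := s - c%:R.
have th_le : `|th| <= 2^-1.
  by rewrite ler_norml /th; lra.
have sE : c%:R + th = s by rewrite /th; ring.
clearbody th.
have dc : (d.*2 + 3 <= c)%N.
  by rewrite -ltnS -(@ltr_nat R) -natr1; lra.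
(* The nodes [c + x] with [|x| <= c-1] run over [1, ..., 2c-1], where [Q] is bounded at the
   reciprocals. *)
have cn : (c.*2.-1 <= n)%N.
  suff : (c.*2 <= n.+1)%N by lia.
  by rewrite -(@ler_nat R) -mul2n natrM -natr1; lra.
have eps_ge0 : 0 <= eps.
  have /Q_le : (0 < 1 <= n)%N by lia.
  exact: le_trans.
pose p := ((\poly_(k < d.+1) Q`_(d - k)) \Po ('X + c%:R%:P)) * (c%:R%:P - 'X) ^+ d.
have pE x : c%:R + x != 0 ->
    p.[x] = (c%:R ^+ 2 - x ^+ 2) ^+ d * Q.[(c%:R + x)^-1].
  move=> cx; rewrite hornerM horner_comp !hornerE addrC horner_reverse //.
  by rewrite mulrAC -exprMn; congr (_ ^+ _ * _); ring.
have sp : (size p <= c.-1.+1)%N.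
  have s1 : (size ((\poly_(k < d.+1) Q`_(d - k)) \Po ('X + c%:R%:P))%R <= d.+1)%N.
    rewrite (leq_trans (size_comp_poly_leq _ _)) // size_XaddC muln1.
    by have := size_poly d.+1 (fun k => Q`_(d - k)); lia.
  have s2 : (size ((c%:R%:P - 'X) ^+ d : {poly R})%R <= d.+1)%N.
    rewrite (leq_trans (size_poly_exp_leq _ _)) //.
    rewrite -opprB size_polyN size_XsubC; lia.
  by rewrite (leq_trans (size_polyMleq _ _)) //; lia.
have c_gt0 : 0 < c%:R :> R by rewrite ltr0n; lia.
have pM (i : 'I_(c.-1).*2.+1) : `|p.[i%:R - c.-1%:R]| <= (c%:R ^+ 2) ^+ d * eps.
  have iN : c%:R + (i%:R - c.-1%:R) = i.+1%:R :> R.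
    by rewrite -[c in c%:R](@prednK c) -?natr1; [ring|lia].
  rewrite pE iN ?pnatr_eq0 // normrM ler_pM //; last first.
    by apply: Q_le; have := ltn_ord i; lia.
  rewrite normrX lerXn2r ?nnegrE ?sqr_ge0 //.
  have i_le : i.+1%:R <= 2%:R * c%:R :> R.
    by rewrite -natrM ler_nat; have := ltn_ord i; clear -dc; lia.
  have -> : i%:R - c.-1%:R = i.+1%:R - c%:R :> R by rewrite -iN; ring.
  rewrite ger0_norm; first by rewrite gerBl sqr_ge0.
  rewrite (_ : _ - _ = i.+1%:R * (2%:R * c%:R - i.+1%:R)); last by ring.
  by rewrite mulr_ge0 // subr_ge0.
have c1_gt0 : (0 < c.-1)%N by clear -dc; lia.
have := center_interpolation_le c1_gt0 th_le sp pM.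
have s_gt0 : 0 < s by apply: lt_le_trans ds; rewrite ltr0n; lia.
rewrite pE sE ?gt_eqF // normrM normrX.
have th2 : th ^+ 2 <= 4^-1 by move: th_le; rewrite ler_norml => /andP[? ?]; nra.
have c3 : 3%:R <= c%:R :> R by rewrite ler_nat; clear -dc; lia.
have c2_gt0 : 0 < c%:R ^+ 2 :> R by rewrite exprn_gt0.
rewrite [`|_ - th ^+ 2|]ger0_norm; last first.
  have : 9%:R <= c%:R ^+ 2 :> R by nra.
  lra.
have cd_gt0 : 0 < (c%:R ^+ 2) ^+ d :> R by rewrite exprn_gt0.
have -> : c%:R ^+ 2 - th ^+ 2 = (1 - th ^+ 2 / c%:R ^+ 2) * c%:R ^+ 2 :> R.
  by rewrite mulrBl mul1r divfK // gt_eqF.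
rewrite exprMn mulrAC [leRHS]mulrCA mulrC ler_pM2l // => h.
have x_le : th ^+ 2 / c%:R ^+ 2 <= (4%:R * c%:R ^+ 2)^-1.
  by rewrite (invfM 4%:R) ler_pM2r ?invr_gt0.
have x_ge0 : 0 <= th ^+ 2 / c%:R ^+ 2 by rewrite divr_ge0 ?sqr_ge0.
have x_le1 : (4%:R * c%:R ^+ 2)^-1 <= 1 :> R.
  by rewrite invf_le1; move: c3; clear; move: (c%:R : R) => k; nra.
have dlec : (d <= c)%N by clear -dc; lia.
have dx : d%:R * (th ^+ 2 / c%:R ^+ 2) <= 2^-1.
  apply: le_trans (_ : c%:R * (4%:R * c%:R ^+ 2)^-1 <= _).
    by apply: ler_pM => //; rewrite ler_nat.
  rewrite ler_pdivrMr; last by rewrite mulr_gt0.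
  by move: c3; clear; move: (c%:R : R) => k; nra.
(* By Bernoulli the prefactor at [th] is at least half of [c^(2d)], which turns 17 into 34. *)
have : 2^-1 <= (1 - th ^+ 2 / c%:R ^+ 2) ^+ d.
  apply: le_trans (bernoulli_le d _); first lra.
  by apply/andP; split => //; lra.
move: h; set e := (_ ^+ d); set q := `|_| => h.
have q_ge0 : 0 <= q by exact: normr_ge0.
clearbody q e; clear -h q_ge0 => e_ge.
have : q * 2^-1 <= q * e by rewrite ler_wpM2l.
lra.
Qed.

(** For [b > 0] the bound [1/(b^2 + j^2) <= 2/((b+j-1)(b+j))] telescopes to at most [2/b]; for
    [b = 0] the comparison is with [1/(j^2 - 1/4)]. *)
Lemma sum_inv_sqr_le (R : realFieldType) (b d : nat) :
  (b.*2.+1)%:R * \sum_(j < d) (b%:R ^+ 2 + j.+1%:R ^+ 2)^-1 <= 6%:R :> R.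
Proof.
have [->|b_gt0] := posnP b.
  have : \sum_(j < d) (0%:R ^+ 2 + j.+1%:R ^+ 2)^-1 <= 2%:R - (d%:R + 2^-1)^-1 :> R.
    elim: d => [|d IH]; first by rewrite big_ord0 add0r invrK subrr.
    rewrite big_ord_recr /=; apply: le_trans (lerD IH (lexx _)) _.
    rewrite expr0n /= add0r.
    have -> : d%:R + 2^-1 = d.+1%:R - 2^-1 :> R by rewrite -natr1; field.
    have : 1 <= d.+1%:R :> R by rewrite ler1n.
    move: (d.+1%:R) => x x_ge1.
    have -> : 2%:R - (x + 2^-1)^-1 = 2%:R - (x - 2^-1)^-1 + (x ^+ 2 - 4^-1)^-1.
      by field; apply/and3P; split; nra.
    by rewrite lerD2l lef_pV2 ?posrE; nra.
  have : 0 <= (d%:R + 2^-1)^-1 :> R by rewrite invr_ge0 addr_ge0 // invr_ge0.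
  by rewrite double0 mul1r; lra.
have b1 : 1 <= b%:R :> R by rewrite ler1n.
have : \sum_(j < d) (b%:R ^+ 2 + j.+1%:R ^+ 2)^-1 <= 2%:R / b%:R - 2%:R / (b + d)%:R :> R.
  elim: d => [|d IH]; first by rewrite big_ord0 addn0 subrr.
  rewrite big_ord_recr /=; apply: le_trans (lerD IH (lexx _)) _.
  rewrite addnS -[(b + d).+1%:R]natr1 -[d.+1%:R]natr1 natrD.
  have : 0 <= d%:R :> R by [].
  move: (b%:R : R) (d%:R : R) b1 => x y x1 y0.
  have -> : 2%:R / x - 2%:R / (x + y + 1) =
     2%:R / x - 2%:R / (x + y) + 2%:R / ((x + y) * (x + y + 1)).
    by field; apply/and3P; split; lra.
  have D_le : (x + y) * (x + y + 1) <= 2%:R * (x ^+ 2 + (y + 1) ^+ 2).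
    have : 0 <= (x - (y + 1)) ^+ 2 by rewrite sqr_ge0.
    nra.
  rewrite lerD2l ler_pdivlMr; last by nra.
  rewrite mulrC ler_pdivrMr //; nra.
have bd : 0 <= 2%:R / (b + d)%:R :> R by rewrite divr_ge0.
have b_gt : 0 < b.*2.+1%:R :> R by [].
move=> S_le; apply: le_trans (_ : b.*2.+1%:R * (2%:R / b%:R) <= _).
  by rewrite ler_pM2l //; lra.
by rewrite mulrA ler_pdivrMr ?ltr0n // -natr1 -mul2n natrM; lra.
Qed.

(** A finite form of the product for [sinh(pi b)/(pi b)]. From [b] to [b+1] the factor of [j >= 1]
    is multiplied by [1 + (2b+1)/(b^2 + j^2)]; bounding this by an exponential, the exponents sum to
    at most 6. *)
Lemma prod_sqr_growth (R : realType) (b d : nat) :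
  \prod_(j < d) (1 + b%:R ^+ 2 / j.+1%:R ^+ 2) <= expR 6%:R ^+ b :> R.
Proof.
elim: b => [|b IH].
  by rewrite expr0 big1 // => j _; rewrite expr0n mul0r addr0.
rewrite [leRHS]exprSr.
apply: le_trans (_ : (\prod_(j < d) (1 + b%:R ^+ 2 / j.+1%:R ^+ 2)) *
  \prod_(j < d) expR (b.*2.+1%:R * (b%:R ^+ 2 + j.+1%:R ^+ 2)^-1) <= _).
  rewrite -big_split /=; apply: ler_prod => j _.
  have j0 : 0 < j.+1%:R ^+ 2 :> R by rewrite exprn_gt0.
  have c0 : 0 <= b%:R ^+ 2 :> R by rewrite sqr_ge0.
  apply/andP; split; first by rewrite addr_ge0 // divr_ge0 ?sqr_ge0 // ltW.
  apply: le_trans (ler_wpM2l _ (expR_ge1Dx _)); last first.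
    by rewrite addr_ge0 // divr_ge0 ?sqr_ge0 // ltW.
  rewrite -[b.+1%:R]natr1 -[b.*2.+1%:R]natr1 -mul2n natrM le_eqVlt.
  apply/orP; left; apply/eqP; field.
  have j_ge0 : 0 <= j%:R :> R by [].
  by apply/andP; split; [rewrite gt_eqF ?ltr_wpDl ?exprn_gt0 ?ltr_pwDl|lra].
apply: ler_pM => //.
- by apply: prodr_ge0 => j _; rewrite addr_ge0 // divr_ge0 // sqr_ge0.
- by apply: prodr_ge0 => j _; rewrite expR_ge0.
- rewrite -expR_sum -mulr_sumr ler_expR; exact: sum_inv_sqr_le.
Qed.

Lemma fact_addn (i d : nat) :
  (0 < i)%N -> ((\prod_(j < d.+1) (i + j)) * i.-1`! = (i + d)`!)%N.
Proof.
move=> i0; elim: d => [|d IH].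
  by rewrite big_ord_recl big_ord0 /= muln1 !addn0 -[in RHS](prednK i0) factS prednK.
by rewrite big_ord_recr /= mulnAC IH addnS factS mulnC.
Qed.

(* These are the Lagrange weights at [0] for the nodes [b^2 + j^2], [j <= d]. *)
Lemma quadratic_weight_le (R : realType) (b d : nat) (i : 'I_d.+1) :
  (0 < b)%N ->
  \prod_(j < d.+1 | j != i)
      ((b%:R ^+ 2 + j%:R ^+ 2) / `|i%:R ^+ 2 - j%:R ^+ 2|) <=
  2%:R * expR 6%:R ^+ b * (b%:R ^+ 2 / (b%:R ^+ 2 + i%:R ^+ 2)) :> R.
Proof.
move=> b_gt0; set E := expR _ ^+ b.
have b2_gt0 : 0 < b%:R ^+ 2 :> R by rewrite exprn_gt0 ?ltr0n.
have pos j : 0 < b%:R ^+ 2 + j%:R ^+ 2 :> R by rewrite ltr_wpDr ?sqr_ge0.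
(* Restoring the missing factor [j = i] gives the full product; its [j = 0] factor is [b^2], the
   others are [j^2 (1 + b^2/j^2)]. *)
have num_le : (\prod_(j < d.+1 | j != i) (b%:R ^+ 2 + j%:R ^+ 2)) *
    (b%:R ^+ 2 + i%:R ^+ 2) <= b%:R ^+ 2 * (d`! * d`!)%:R * E :> R.
  have -> : (\prod_(j < d.+1 | j != i) (b%:R ^+ 2 + j%:R ^+ 2)) *
    (b%:R ^+ 2 + i%:R ^+ 2) = \prod_(j < d.+1) (b%:R ^+ 2 + j%:R ^+ 2) :> R.
    by rewrite [RHS](bigD1 i) //= mulrC.
  rewrite big_ord_recl expr0n addr0 -mulrA ler_pM2l //.
  apply: le_trans (_ : (d`! * d`!)%:R *
      \prod_(j < d) (1 + b%:R ^+ 2 / j.+1%:R ^+ 2) <= _); last first.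
    by rewrite ler_wpM2l // prod_sqr_growth.
  have -> : (d`! * d`!)%:R = \prod_(j < d) j.+1%:R ^+ 2 :> R.
    rewrite natrM fact_prod big_add1 big_mkord natr_prod -big_split /=.
    by apply: eq_bigr => j _; rewrite expr2.
  rewrite -big_split /= le_eqVlt; apply/orP; left; apply/eqP.
  apply: eq_bigr => j _; rewrite /bump /= add1n.
  by field; have : 0 <= j%:R :> R by []; lra.
(* In [i^2 - j^2 = (i-j)(i+j)] the differences give [i!(d-i)!]. For [i > 0] the sums give
   [(d+i)!/(2 i!)], the 2 coming from the omitted factor [i + i], so twice the product is
   [(d-i)!(d+i)! >= d!^2]. *)
have den : (d`! * d`!)%:R <=
    \prod_(j < d.+1 | j != i) `|i%:R ^+ 2 - j%:R ^+ 2| * 2%:R :> R.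
  under eq_bigr => j _ do
    rewrite subr_sqr normrM -[i%:R + j%:R]natrD [`|(i + j)%:R|]normr_nat.
  rewrite big_split /= prod_dist_nat -natr_prod -!natrM ler_nat.
  have iE : (i + (d - i) = d)%N by have := ltn_ord i; lia.
  have [i0|i_gt0] := posnP i.
    have -> : (\prod_(j < d.+1 | j != i) (i + j) = d`!)%N.
      rewrite i0 fact_prod big_add1 big_mkord big_mkcond big_ord_recl /=.
      have -> : i = ord0 by apply: val_inj.
      by rewrite eqxx mul1n; apply: eq_bigr => j _; rewrite add0n.
    by rewrite i0 subn0 fact0 mul1n; lia.
  have sE : ((\prod_(j < d.+1 | j != i) (i + j)) * 2 * i`! = (i + d)`!)%N.
    rewrite -(fact_addn d i_gt0) [X in (_ = X * _)%N](bigD1 i) //= addnn -muln2.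
    have -> : i`! = (i * i.-1`!)%N by rewrite -{1 2}(prednK i_gt0) factS prednK.
    by ring.
  have := @fact_sqr_le d (i + d) _.
  have -> : (d.*2 - (i + d) = d - i)%N by lia.
  move=> /(_ ltac:(lia)); rewrite -sE.
  by move=> /leq_trans; apply; apply: eq_leq; ring.
have den_gt0 : 0 < \prod_(j < d.+1 | j != i) `|i%:R ^+ 2 - j%:R ^+ 2| :> R.
  have : 0 < (d`! * d`!)%:R :> R by rewrite ltr0n muln_gt0 fact_gt0.
  lra.
rewrite prodf_div ler_pdivrMr // mulrA mulrAC ler_pdivlMr //.
apply: le_trans num_le _.
rewrite [leRHS](_ : _ = b%:R ^+ 2 *
  (\prod_(j < d.+1 | j != i) `|i%:R ^+ 2 - j%:R ^+ 2| * 2%:R) * E); last by ring.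
by rewrite ler_wpM2r ?exprn_ge0 ?expR_ge0 // ler_wpM2l // ltW.
Qed.

(** Lagrange interpolation at 0 from the nodes [2(b^2 + j^2)/(n b^2)], [j <= d]. Their quadratic
    spacing, like that of Chebyshev nodes near an endpoint, keeps the weights down to
    [exp(O(b))]. *)
Lemma extrapolation_to_0 (R : realType) (d b n : nat) (Q : {poly R}) (eps : R) :
  (0 < b)%N -> (size Q <= d.+1)%N ->
  (forall N : nat, (0 < N <= n)%N -> `|Q.[N%:R^-1]| <= eps) ->
  (2 * (b ^ 2 + d ^ 2) * (d.*2 + 3) <= n * b ^ 2)%N ->
  `|Q.[0]| <= (272%:R * expR 6%:R) ^+ b * eps.
Proof.
move=> b_gt0 sQ Q_le n_ge; set E := expR 6%:R.
have n_gt0 : (0 < n)%N.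
  have : (0 < n * b ^ 2)%N.
    apply: leq_trans n_ge; rewrite !muln_gt0 addn_gt0 expn_gt0 b_gt0 /=; lia.
  by rewrite muln_gt0 => /andP[].
have eps_ge0 : 0 <= eps.
  have /Q_le : (0 < 1 <= n)%N by lia.
  exact: le_trans.
have nR : 0 < n%:R :> R by rewrite ltr0n.
have b2_gt0 : 0 < b%:R ^+ 2 :> R by rewrite exprn_gt0 ?ltr0n.
have pos j : 0 < b%:R ^+ 2 + j%:R ^+ 2 :> R by rewrite ltr_wpDr ?sqr_ge0.
pose s j : R := n%:R * b%:R ^+ 2 / (2%:R * (b%:R ^+ 2 + j%:R ^+ 2)).
pose u (j : 'I_d.+1) : R := (s j)^-1.
have uE j : u j = (b%:R ^+ 2 + j%:R ^+ 2) * (2%:R / (n%:R * b%:R ^+ 2)).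
  rewrite /u /s; have := pos j => pj; field.
  by rewrite !gt_eqF ?ltr0n.
have g_gt0 : 0 < 2%:R / (n%:R * b%:R ^+ 2) :> R by rewrite divr_gt0 ?mulr_gt0 ?ltr0n.
have u_inj : injective u.
  move=> i j; rewrite !uE => /(mulIf (lt0r_neq0 g_gt0)) /addrI /eqP.
  by rewrite eqrXn2 // eqr_nat => /eqP/val_inj.
(* The [s j] decrease from [s 0 = n/2] to [s d], and the hypothesis on [n] says exactly that
   [s d >= 2d+3]. *)
have Qu j : `|Q.[u j]| <= 34%:R * eps.
  apply: (bounded_between_integers sQ Q_le).
    rewrite ler_pdivlMr ?mulr_gt0 // -!natrX -natrD -!natrM ler_nat.
    apply: leq_trans n_ge; rewrite mulnC leq_mul2r leq_mul2l leq_add2l.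
    by rewrite leq_exp2r // -ltnS ltn_ord !orbT.
  rewrite mulrA ler_pdivrMr ?mulr_gt0 // mulrCA ler_pM2l // ler_pM2l //.
  by rewrite lerDl sqr_ge0.
rewrite (lagrange_interpolation 0 u_inj sQ) (le_trans (ler_norm_sum _ _ _)) //.
apply: le_trans (_ : \sum_(i < d.+1) 34%:R * eps *
   (2%:R * E ^+ b * (b%:R ^+ 2 / (b%:R ^+ 2 + i%:R ^+ 2))) <= _).
  apply: ler_sum => i _; rewrite normrM ler_pM ?Qu //.
  apply: le_trans (quadratic_weight_le R i b_gt0).
  rewrite normr_prod le_eqVlt; apply/orP; left; apply/eqP.
  apply: eq_bigr => j _.
  rewrite sub0r !uE -mulrBl -mulNr -mulf_div divff ?gt_eqF // mulr1.
  rewrite normrM normrN normfV gtr0_norm //; congr (_ / `|_|); ring.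
rewrite -mulr_sumr -mulr_sumr.
have S_le : \sum_(i < d.+1) (b%:R ^+ 2 / (b%:R ^+ 2 + i%:R ^+ 2)) <= 4%:R ^+ b :> R.
  rewrite big_ord_recl expr0n addr0 divff ?gt_eqF //= -mulr_sumr.
  have := sum_inv_sqr_le R b d; set S := \sum_(_ < _) _ => h.
  have h1 : b%:R * S <= 3%:R.
    have S0 : 0 <= S by apply: sumr_ge0 => j _; rewrite invr_ge0 ltW.
    by move: h; rewrite -natr1 -mul2n natrM => h; lra.
  apply: le_trans (_ : 1 + 3%:R * b%:R <= _).
    by rewrite lerD2l expr2 -mulrA [leRHS]mulrC ler_wpM2l.
  rewrite -natrM -natrX nat1r ler_nat.
  elim: (b) => // k IH; rewrite expnS; lia.
have E_ge0 : 0 <= E ^+ b by rewrite exprn_ge0 ?expR_ge0.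
(* [272 = 34 * 2 * 4]: 34 from the bound between integers, 2 from the weights, 4 from [S_le]. As
   [b > 0], the constant 68 fits into [68^b]. *)
have p_le : 68%:R <= 68%:R ^+ b :> R by rewrite -{1}[68%:R]expr1 ler_weXn2l // ler1n.
rewrite (_ : 272%:R = 68%:R * 4%:R); last by rewrite -natrM.
rewrite !exprMn; set S := \sum_(_ < _) _ in S_le *.
have S_ge0 : 0 <= S by apply: sumr_ge0 => j _; rewrite divr_ge0 // ltW.
clearbody S.
rewrite (_ : _ * _ = 68%:R * S * (E ^+ b * eps)); last by ring.
by rewrite -[leRHS]mulrA ler_wpM2r ?mulr_ge0 // ler_pM.
Qed.

(** * Small-range distributions *)

(** Bits are idempotent, so sets of variables index all monomials. The inductive form reduces
    statements linear in the function to a single monomial. *)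
Inductive degree_le (K : pzRingType) (I : finType) (D : nat) :
    ({ffun I -> bool} -> K) -> Prop :=
| degree_monomial (c : K) (S : {set I}) :
    (#|S| <= D)%N -> degree_le D (fun x => c * [forall v in S, x v]%:R)
| degree_add F G :
    degree_le D F -> degree_le D G -> degree_le D (fun x => F x + G x).

(** Precomposing with a transposition shows that all points outside [s] are equally likely to be
    sent into [B]. The identity then counts in two ways the pairs of a permutation in [X] and a
    point outside [s] that it sends into [B]. *)
Lemma perm_extension_count (T : finType) (X : {perm T} -> bool) (s : seq T)
    (j : T) (B : {set T}) (k : nat) :
  (forall sg tau : {perm T}, {in s, sg =1 tau} -> X sg = X tau) ->
  uniq s -> j \notin s ->
  (forall tau : {perm T}, X tau -> #|B :\: [set tau i | i in s]| = k) ->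
  ((#|T| - size s) * #|[set tau : {perm T} | X tau && (tau j \in B)]| =
   k * #|[set tau : {perm T} | X tau]|)%N.
Proof.
move=> Xs s_uniq js Bk.
have E i : i \notin s -> #|[set tau : {perm T} | X tau && (tau i \in B)]| =
    #|[set tau : {perm T} | X tau && (tau j \in B)]|.
  move=> i_s; rewrite -(card_imset _ (mulgI (tperm i j))); apply: eq_card => tau.
  rewrite inE; apply/imsetP/idP => [[sg + ->]|tauB].
    rewrite inE permM tpermR => /andP[Xsg ->]; rewrite andbT.
    rewrite -(Xs sg) // => l ls; rewrite permM tpermD //.
      by apply: contraNneq i_s => ->.
    by apply: contraNneq js => ->.
  exists (tperm i j * tau)%g; last by rewrite mulgA tperm2 mul1g.
  case/andP: tauB => Xtau tauB; rewrite inE permM tpermL tauB andbT.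
  rewrite -(Xs tau) // => l ls; rewrite permM tpermD //.
    by apply: contraNneq i_s => ->.
  by apply: contraNneq js => ->.
have -> : (#|T| - size s)%N = #|[predC s]|.
  by rewrite -(card_uniqP s_uniq) -(cardC [in s]) addKn; apply: eq_card.
rewrite -sum_nat_const.
rewrite (eq_bigr (fun i => #|[set tau : {perm T} | X tau && (tau i \in B)]|)); last first.
  by move=> i; rewrite inE => /E.
rewrite mulnC -sum_nat_const.
under eq_bigr => i _ do rewrite -sum1_card big_mkcond /=.
rewrite exchange_big /= [RHS]big_mkcond; apply: eq_bigr => tau _.
rewrite inE; case: (boolP (X tau)) => [Xtau|nX]; last first.
  by rewrite big1 // => i _; rewrite inE (negPf nX).
rewrite -(Bk _ Xtau); under eq_bigr => i _ do rewrite inE Xtau /=.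
rewrite -big_mkcondr sum1_card -[LHS](card_imset _ (@perm_inj _ tau)).
apply: eq_card => l; apply/imsetP/idP => [[i + ->]|].
  rewrite unfold_in !inE => /andP[i_s iB]; rewrite iB andbT.
  by apply: contra i_s => /imsetP[i' i's /perm_inj ->].
rewrite finset.in_setD => /andP[lJ lB]; exists (tau^-1 l)%g; last by rewrite permKV.
rewrite unfold_in !inE permKV lB andbT /=; apply: contra lJ => ls.
by apply/imsetP; exists (tau^-1 l)%g; rewrite ?permKV.
Qed.

Lemma card_permT (T : finType) : #|[set: {perm T}]| = (#|T|)`!.
Proof.
rewrite -[in RHS]cardsT -card_perm; apply: eq_card => tau.
by rewrite !inE; apply/esym/fintype.subsetP => i _; rewrite inE.
Qed.

(** The points of [s] are placed one at a time: after [l] of them, [|B| - l] of the [|T| - l]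
    remaining values are allowed. *)
Lemma perm_into_count (T : finType) (s : seq T) (B : {set T}) :
  uniq s ->
  (#|T| ^_ (size s) * #|[set tau : {perm T} | all (fun i => tau i \in B) s]| =
   (#|T|)`! * #|B| ^_ (size s))%N.
Proof.
elim: s => [|j s IH] /=.
  move=> _; rewrite !ffactn0 mul1n muln1 -card_permT.
  by apply: eq_card => tau; rewrite !inE.
case/andP=> js s_uniq.
have -> : [set tau : {perm T} | (tau j \in B) && all (fun i => tau i \in B) s] =
   [set tau : {perm T} | all (fun i => tau i \in B) s && (tau j \in B)].
  by apply/setP => tau; rewrite !inE andbC.
rewrite !ffactnSr -mulnA (@perm_extension_count _ _ _ _ _ (#|B| - size s)) //.
- by rewrite mulnCA IH // mulnC mulnA.
- by move=> sg tau e; apply: eq_in_all => i si; rewrite e.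
- move=> tau /allP tB; rewrite cardsD (finset.setIidPr _).
    by rewrite card_imset ?(card_uniqP s_uniq) //; exact: perm_inj.
  by apply/fintype.subsetP => _ /imsetP[i si ->]; apply: tB.
Qed.

Lemma perm_graph_count (T : finType) (s : seq (T * T)) :
  uniq (unzip1 s) -> uniq (unzip2 s) ->
  (#|T| ^_ (size s) * #|[set tau : {perm T} | all (fun p => tau p.1 == p.2) s]| =
   (#|T|)`!)%N.
Proof.
elim: s => [|[i j] s IH] /=.
  by move=> _ _; rewrite ffactn0 mul1n -card_permT; apply: eq_card => tau; rewrite !inE.
case/andP=> i_s s1 /andP[j_s s2].
have -> : [set tau : {perm T} | (tau i == j) && all (fun p => tau p.1 == p.2) s] =
   [set tau : {perm T} | all (fun p => tau p.1 == p.2) s && (tau i \in [set j])].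
  by apply/setP => tau; rewrite !inE andbC.
rewrite ffactnSr -mulnA -(size_map fst s) (@perm_extension_count _ _ _ _ _ 1) //.
- by rewrite mul1n size_map IH.
- move=> sg tau e; apply: eq_in_all => p ps; rewrite e //.
  by apply: map_f.
- move=> tau /allP tE; rewrite (_ : _ :\: _ = [set j]) ?cards1 //.
  apply/setP => l; rewrite !inE; case: eqP => [->|]; last by rewrite andbF.
  rewrite andbT; apply: contra j_s => /imsetP[_ /mapP[p ps ->] ->].
  by rewrite (eqP (tE _ ps)); apply: map_f.
Qed.

Definition graph_input (n : nat) (f : 'I_n -> 'I_n) : {ffun 'I_n * 'I_n -> bool} :=
  [ffun v => f v.1 == v.2].

Definition small_range (n N : nat) (le_Nn : (N <= n)%N) (tau : {perm 'I_n})
    (h : {ffun 'I_n -> 'I_N}) (i : 'I_n) : 'I_n :=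
  tau (widen_ord le_Nn (h i)).

(** For fixed [tau] the rows impose independent constraints: a row met by [S] forces the value of
    [h], which must be below [N]; the other [n - |S|] rows are free. *)
Lemma small_range_count (n N : nat) (le_Nn : (N <= n)%N) (tau : {perm 'I_n})
    (S : {set 'I_n * 'I_n}) :
  {in S &, injective fst} ->
  (#|[set h : {ffun 'I_n -> 'I_N} |
        [forall v in S, graph_input (small_range le_Nn tau h) v]]| * N ^ #|S| =
   N ^ n * [forall v in S, (tau^-1 v.2)%g < N])%N.
Proof.
move=> S_fun.
pose F (i : 'I_n) : pred 'I_N :=
  fun b => [forall v in S, (v.1 == i) ==> (tau (widen_ord le_Nn b) == v.2)].
have -> : #|[set h : {ffun 'I_n -> 'I_N} |
    [forall v in S, graph_input (small_range le_Nn tau h) v]]| = #|family F|.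
  apply: eq_card => h; rewrite inE; apply/forall_inP/familyP => [hS i|hF v vS].
    by apply/forall_inP => v vS; apply/implyP => /eqP <-; have := hS v vS; rewrite ffunE.
  by have /forall_inP/(_ v vS) := hF v.1; rewrite eqxx ffunE.
have Fout i : i \notin [set v.1 | v in S] -> #|F i| = N.
  move=> iS; rewrite -[RHS]card_ord; apply: eq_card => b; rewrite [RHS]inE.
  apply/forall_inP => v vS; apply/implyP => /eqP vi; move: iS.
  by rewrite -vi => /imsetP[]; exists v.
have Fin v : v \in S -> #|F v.1| = ((tau^-1 v.2)%g < N)%N.
  move=> vS; case: ltnP => [vN|Nv].
    rewrite -[RHS]/1%N -(card1 (Ordinal vN)); apply: eq_card => b; rewrite [RHS]inE.
    apply/forall_inP/eqP => [/(_ v vS)|-> w wS].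
      rewrite eqxx /= => /eqP tb; apply: val_inj => /=.
      by rewrite -tb permK.
    apply/implyP => /eqP vw; rewrite (S_fun _ _ wS vS vw).
    by rewrite (_ : widen_ord _ _ = (tau^-1 v.2)%g) ?permKV //; apply: val_inj.
  apply: eq_card0 => b; apply/negbTE/negP => /forall_inP/(_ v vS).
  rewrite eqxx /= => /eqP tb; move: Nv; rewrite -tb permK leqNgt.
  by rewrite /= ltn_ord.
rewrite card_family foldrE big_image /=.
rewrite (bigID (mem [set v.1 | v in S])) /=.
rewrite [X in (_ * X * _)%N](eq_bigr (fun=> N)) => [|i /Fout //].
rewrite prod_nat_const big_imset //=.
rewrite (eq_bigr (fun v : 'I_n * 'I_n => ((tau^-1 v.2)%g < N)%N : nat)); last first.
  by move=> v /Fin.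
rewrite -mulnA -expnD -(card_in_imset S_fun).
have -> : (#|[predC [set v.1 | v in S]]| + #|[set v.1 | v in S]| = n)%N.
  by rewrite addnC cardC card_ord.
rewrite mulnC; congr (_ * _)%N.
case: forall_inP => [allS|nall].
  by rewrite big1 // => v /allS ->.
have /forall_inPn[v vS vN] : ~~ [forall v in S, (tau^-1 v.2)%g < N]%N.
  by apply/negP => /forall_inP.
by rewrite (bigD1 v) //= (negPf vN) mul0n.
Qed.

Definition average (R : fieldType) (T : finType) (F : T -> R) : R :=
  (\sum_t F t) / #|T|%:R.

Lemma averageD (R : fieldType) (T : finType) (F G : T -> R) :
  average (fun t => F t + G t) = average F + average G.
Proof. by rewrite /average big_split mulrDl. Qed.

Lemma average_indicator (R : fieldType) (T : finType) (c : R) (P : pred T) :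
  average (fun t => c * (P t)%:R) = c * #|[set t | P t]|%:R / #|T|%:R.
Proof.
rewrite /average -mulr_sumr -sum1_card natr_sum [in RHS]big_mkcond /=.
by congr (_ * _ / _); apply: eq_bigr => t _; rewrite inE; case: (P t).
Qed.

(** This makes [N^_v / N^v] a polynomial in [1/N], the source of [Q] in [small_range_polynomial]. *)
Lemma prod_1subV (R : numFieldType) (N v : nat) : (0 < N)%N ->
  N%:R ^+ v * \prod_(i < v) (1 - i%:R / N%:R) = (N ^_ v)%:R :> R.
Proof.
move=> N_gt0; have N0 : N%:R != 0 :> R by rewrite pnatr_eq0 -lt0n.
elim: v => [|v IH]; first by rewrite big_ord0 mulr1 ffactn0.
rewrite big_ord_recr /= exprSr mulrACA IH ffactnSr natrM mulrBr mulr1.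
rewrite mulrCA divff // mulr1.
(* Beyond [v = N] the subtraction [N - v] truncates, but the falling factorial is already 0. *)
case: (leqP v N) => vN; first by rewrite natrB.
by rewrite ffact_small // !mul0r.
Qed.

(* [Q.[N^-1]] averages over the small-range functions with [N] values; the
   permutations are the limit [N = +oo]. *)
Lemma small_range_polynomial (R : numFieldType) (n D : nat)
    (F : {ffun 'I_n * 'I_n -> bool} -> R) :
  degree_le D F ->
  exists Q : {poly R}, [/\ (size Q <= D.+1)%N,
    forall (N : nat) (le_Nn : (N <= n)%N), (0 < N)%N ->
      Q.[N%:R^-1] = average (fun p : {perm 'I_n} * {ffun 'I_n -> 'I_N} =>
                       F (graph_input (small_range le_Nn p.1 p.2)))
    & Q.[0] = average (fun tau : {perm 'I_n} => F (graph_input tau))].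
Proof.
elim=> [c S SD|{}F G _ [P [sP PN P0]] _ [Q [sQ QN Q0]]]; last first.
  exists (P + Q); split.
  - by rewrite (leq_trans (size_polyD _ _)) // geq_max sP.
  - by move=> N le_Nn N0; rewrite hornerD (PN _ le_Nn) // (QN _ le_Nn) // averageD.
  - by rewrite hornerD P0 Q0 averageD.
(* Two distinct entries in one row are never both 1 in a graph, so such a monomial averages to 0. *)
case: (boolP [forall u in S, forall w in S, (u.1 == w.1) ==> (u == w)]); last first.
  move=> /forall_inPn[u uS /forall_inPn[w wS]]; rewrite negb_imply => /andP[/eqP uw1 uw].
  have F0 f : [forall v in S, graph_input f v] = false.
    apply/negbTE/negP => /forall_inP fS; move: (fS u uS) (fS w wS).
    rewrite !ffunE uw1 => /eqP u2 /eqP w2; case/eqP: uw.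
    by rewrite [u]surjective_pairing [w]surjective_pairing uw1 -u2 -w2.
  exists 0; split; first by rewrite size_poly0.
    by move=> N le_Nn _; rewrite horner0 /average big1 ?mul0r // => p _; rewrite F0 mulr0.
  by rewrite horner0 /average big1 ?mul0r // => p _; rewrite F0 mulr0.
move=> /forall_inP S_fun.
have {}S_fun : {in S &, injective fst}.
  by move=> u w uS wS /eqP uw; have /forall_inP/(_ w wS)/implyP/(_ uw)/eqP := S_fun u uS.
pose J := [set v.2 | v in S]; pose v := #|J|.
have vS : (v <= #|S|)%N by apply: leq_imset_card.
have vn : (v <= n)%N by rewrite -[n in (_ <= n)%N]card_ord max_card.
have nv0 : (n ^_ v)%:R != 0 :> R by rewrite pnatr_eq0 -lt0n ffact_gt0.
(* The columns of [S] all lie in the image under [tau] of the first [N] points with probability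
   [N^_v / n^_v]; given this, [h] hits every entry with probability [N^-|S|]. *)
exists ((c / (n ^_ v)%:R) *: ('X^(#|S| - v) * \prod_(i < v) (1 - i%:R *: 'X))).
split.
- rewrite (leq_trans (size_scale_leq _ _)) // (leq_trans (size_polyMleq _ _)) //.
  rewrite size_polyXn /=.
  have sp : (size (\prod_(i < v) (1 - i%:R *: 'X : {poly R}))%R <= v.+1)%N.
    elim: (v) => [|k IH]; first by rewrite big_ord0 size_poly1.
    rewrite big_ord_recr /= (leq_trans (size_polyMleq _ _)) //.
    have : (size (1 - k%:R *: 'X : {poly R})%R <= 2)%N.
      rewrite (leq_trans (size_polyD _ _)) // geq_max size_poly1 size_polyN.
      by rewrite (leq_trans (size_scale_leq _ _)) ?size_polyX.
    move: (size _) (size _) IH => a b; lia.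
  move: (size _) sp vS SD => a; clearbody v; move: #|S| => k; lia.
- move=> N le_Nn N_gt0.
  have N0 : N%:R != 0 :> R by rewrite pnatr_eq0 -lt0n.
  rewrite (average_indicator c
    (fun p : {perm 'I_n} * {ffun 'I_n -> 'I_N} =>
       [forall v in S, graph_input (small_range le_Nn p.1 p.2) v])).
  set C := (X in c * X%:R / _).
  have CE : (C * N ^ #|S| * n ^_ v = N ^ n * (n`! * N ^_ v))%N.
    pose A := (\sum_(tau : {perm 'I_n})
      #|[set h : {ffun 'I_n -> 'I_N} |
        [forall v in S, graph_input (small_range le_Nn tau h) v]]|)%N.
    have -> : C = A.
      rewrite /C -sum1_card big_mkcond /= /A.
      transitivity (\sum_(tau : {perm 'I_n}) \sum_(h : {ffun 'I_n -> 'I_N})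
        if [forall v in S, graph_input (small_range le_Nn tau h) v] then 1 else 0)%N.
        by rewrite pair_bigA /=; apply: eq_bigr => -[tau h] _; rewrite !inE.
      apply: eq_bigr => tau _; rewrite -sum1_card [RHS]big_mkcond.
      by apply: eq_bigr => h _; rewrite inE.
    rewrite /A big_distrl /=.
    rewrite (eq_bigr _ (fun tau _ => small_range_count le_Nn tau S_fun)).
    rewrite -big_distrr /= -mulnA; congr (_ * _)%N.
    (* In terms of the inverse of [tau], the condition is that [J] is sent into the first [N]
       points. *)
    rewrite (reindex_inj invg_inj) /=.
    pose B := [set i : 'I_n | (i < N)%N].
    have cB : #|B| = N.
      rewrite -sum1_card big_mkcond /= -[RHS](card_ord N) -sum1_card.
      rewrite (big_ord_widen n (fun=> 1%N) le_Nn) [RHS]big_mkcond.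
      by apply: eq_bigr => i _; rewrite inE.
    have := perm_into_count B (enum_uniq J).
    rewrite -cardE card_ord cB mulnC => <-; congr (_ * _)%N.
    rewrite -sum1_card [RHS]big_mkcond; apply: eq_bigr => tau _.
    rewrite inE invgK; case: forall_inP => [allS|nall].
      by case: allP => // -[] x; rewrite mem_enum => /imsetP[w wS ->]; rewrite inE allS.
    case: allP => // allJ; case: nall => w wS.
    have := allJ w.2; rewrite mem_enum inE; apply.
    by apply/imsetP; exists w.
  have CR : C%:R * N%:R ^+ #|S| * (n ^_ v)%:R = N%:R ^+ n * (n`!%:R * (N ^_ v)%:R) :> R.
    by rewrite -!natrX -!natrM CE.
  rewrite hornerZ hornerM hornerXn horner_prod.
  rewrite (eq_bigr (fun i : 'I_v => 1 - i%:R / N%:R)); last first.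
    by move=> i _; rewrite hornerD hornerN hornerZ hornerX hornerC.
  rewrite card_prod card_Sn card_ffun !card_ord natrM natrX.
  move: CR; rewrite -(prod_1subV R v N_gt0); set p := \prod_(_ < _) _ => CR.
  have NX k : N%:R ^+ k != 0 :> R by rewrite expf_neq0.
  have f0 : n`!%:R != 0 :> R by rewrite pnatr_eq0 -lt0n fact_gt0.
  apply: (mulIf (NX #|S|)); apply: (mulIf nv0).
  rewrite exprVn -[in N%:R ^+ #|S|](subnK vS) exprD.
  have {}CR : C%:R * (N%:R ^+ #|S|) * (n ^_ v)%:R / (n`!%:R * N%:R ^+ n) = N%:R ^+ v * p.
    by rewrite CR; field; rewrite f0 NX.
  move: CR; rewrite -[in N%:R ^+ #|S|](subnK vS) exprD => CR.
  move: CR nv0 f0 (NX (#|S| - v)%N) (NX v) (NX n); clear.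
  move: (N%:R ^+ _) (N%:R ^+ v) (N%:R ^+ n) (n`!%:R) ((n ^_ v)%:R) (C%:R : R).
  move=> x y M f w a CR w0 f0 x0 y0 M0.
  transitivity (c * (y * p)); [|rewrite -CR]; field; rewrite ?w0 ?f0 ?x0 ?M0 //.
- rewrite average_indicator hornerZ hornerM hornerXn horner_prod.
  rewrite [X in _ * (_ * X)]big1 ?mulr1; last first.
    by move=> i _; rewrite hornerD hornerN hornerZ hornerX hornerC mulr0 subr0.
  (* If the columns of [S] are distinct, a permutation matches [S] with probability [1 / n^_v]. If
     two coincide, none does, and the factor ['X^(#|S| - v)] vanishes at 0. *)
  case: (eqVneq v #|S|) => [vE|vN].
    have S_inj : {in S &, injective snd} by apply/imset_injP; rewrite -/J -/v vE.
    rewrite -vE subnn expr0 mulr1 card_Sn.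
    have := @perm_graph_count _ (enum S).
    rewrite /unzip1 /unzip2 !map_inj_in_uniq ?enum_uniq; first last.
    - by move=> u w; rewrite !mem_enum; exact: S_fun.
    - by move=> u w; rewrite !mem_enum; exact: S_inj.
    move=> /(_ isT isT); rewrite -cardE -vE card_ord => CE.
    have f0 : n`!%:R != 0 :> R by rewrite pnatr_eq0 -lt0n fact_gt0.
    set C := #|_|.
    have {}CE : (n ^_ v)%:R * C%:R = n`!%:R :> R.
      rewrite -CE natrM; congr (_ * _%:R); apply: eq_card => tau; rewrite !inE.
      apply/forall_inP/allP => [tS w|tS w wS].
        by rewrite mem_enum => /tS; rewrite ffunE.
      by rewrite ffunE tS // mem_enum.
    have C0 : C%:R != 0 :> R by apply: contraNneq f0 => C0; rewrite -CE C0 mulr0.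
    by rewrite -CE; field; rewrite nv0 C0.
  rewrite expr0n subn_eq0 leqNgt ltn_neqAle vN vS /= mulr0.
  rewrite (_ : [set _ | _] = finset.set0) ?cards0 ?mulr0 ?mul0r //.
  apply/setP => tau; rewrite !inE; apply/negbTE; apply: contra vN => /forall_inP tS.
  apply/eqP/card_in_imset => u w uS wS uw; apply: S_fun => //.
  move: (tS u uS) (tS w wS); rewrite !ffunE uw => /eqP <- /eqP /perm_inj <-//.
Qed.

(** * The acceptance operator of a QMA protocol *)

Section DegreeTheory.
Variables (I : finType).
Implicit Types (K : pzRingType) (D : nat).

Lemma eq_degree_le K D (F G : {ffun I -> bool} -> K) :
  F =1 G -> degree_le D F -> degree_le D G.
Proof. by move=> /funext ->. Qed.

Lemma degree_le_cst K D (c : K) : degree_le D (fun _ : {ffun I -> bool} => c).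
Proof.
apply: eq_degree_le (degree_monomial c (_ : #|(finset.set0 : {set I})| <= D)%N);
  last by rewrite cards0.
move=> x; case: forall_inP => [_|[]]; first by rewrite mulr1.
by move=> v; rewrite inE.
Qed.

Lemma degree_le_var K (j : I) :
  degree_le 1 (fun x : {ffun I -> bool} => (x j)%:R : K).
Proof.
apply: eq_degree_le (degree_monomial 1 (_ : #|[set j]| <= 1)%N); last by rewrite cards1.
move=> x; rewrite mul1r; congr (nat_of_bool _)%:R.
apply/forall_inP/idP => [|xj v]; first by apply; rewrite inE.
by rewrite inE => /eqP ->.
Qed.

Lemma degree_leW K D D' (F : {ffun I -> bool} -> K) :
  (D <= D')%N -> degree_le D F -> degree_le D' F.
Proof.
move=> DD; elim=> [c S SD|{}F G _ ? _ ?]; last exact: degree_add.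
by apply: degree_monomial; apply: leq_trans DD.
Qed.

Lemma degree_le_sum K D (J : Type) (r : seq J) (P : pred J)
    (F : J -> {ffun I -> bool} -> K) :
  (forall j, P j -> degree_le D (F j)) ->
  degree_le D (fun x => \sum_(j <- r | P j) F j x).
Proof.
move=> FD; elim: r => [|j r IH].
  by apply: eq_degree_le (degree_le_cst D 0) => x; rewrite big_nil.
have [Pj|nPj] := boolP (P j).
  apply: eq_degree_le (degree_add (FD j Pj) IH) => x.
  by rewrite big_cons Pj.
by apply: eq_degree_le IH => x; rewrite big_cons (negPf nPj).
Qed.

(** Monomials take only the values 0 and 1, so additivity suffices. Applied to complex conjugation
    and to the real part. *)
Lemma degree_le_comp (K L : pzRingType) D (f : K -> L)
    (F : {ffun I -> bool} -> K) :
  f 0 = 0 -> {morph f : a b / a + b} -> degree_le D F ->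
  degree_le D (fun x => f (F x)).
Proof.
move=> f0 fD; elim=> [c S SD|{}F G _ IF _ IG].
  apply: eq_degree_le (degree_monomial (f c) SD) => x /=.
  by case: [forall v in S, x v]; rewrite ?mulr1 ?mulr0 ?f0.
by apply: eq_degree_le (degree_add IF IG) => x; rewrite fD.
Qed.

Lemma degree_leM (K : comPzRingType) D D' (F G : {ffun I -> bool} -> K) :
  degree_le D F -> degree_le D' G -> degree_le (D + D') (fun x => F x * G x).
Proof.
move=> FD; move: G; elim: FD => [c S SD|{}F F' _ IF _ IF'] G; last first.
  move=> GD; apply: eq_degree_le (degree_add (IF _ GD) (IF' _ GD)) => x.
  by rewrite mulrDl.
elim=> [c' S' SD'|{}G G' _ IG _ IG']; last first.
  by apply: eq_degree_le (degree_add IG IG') => x; rewrite mulrDr.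
have cU : (#|S :|: S'| <= D + D')%N.
  by rewrite (leq_trans _ (leq_add SD SD')) // -cardsUI leq_addr.
apply: eq_degree_le (degree_monomial (c * c') cU) => x.
rewrite mulrACA -natrM mulnb; congr (_ * (nat_of_bool _)%:R).
apply/forall_inP/andP => [h|[/forall_inP h /forall_inP h'] v].
  by split; apply/forall_inP => v vS; apply: h; rewrite inE vS ?orbT.
by rewrite inE => /orP[/h|/h'].
Qed.

Definition mx_degree_le (K : pzRingType) (p q D : nat)
    (A : {ffun I -> bool} -> 'M[K]_(p, q)) : Prop :=
  forall i j, degree_le D (fun x => A x i j).

Lemma mx_degree_leM (K : comPzRingType) (p q r D D' : nat)
    (A : {ffun I -> bool} -> 'M[K]_(p, q)) (B : {ffun I -> bool} -> 'M[K]_(q, r)) :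
  mx_degree_le D A -> mx_degree_le D' B ->
  mx_degree_le (D + D') (fun x => A x *m B x).
Proof.
move=> AD BD i j.
apply: eq_degree_le (degree_le_sum (index_enum _) (P := xpredT) _) => [x|k _].
  by rewrite mxE.
exact: degree_leM.
Qed.

Lemma mx_degree_le_cst (K : pzRingType) (p q D : nat) (A : 'M[K]_(p, q)) :
  mx_degree_le D (fun=> A).
Proof. by move=> i j; exact: degree_le_cst. Qed.

End DegreeTheory.

(** An entry depends on at most one bit; interpolating between the two values of that bit makes it
    affine. *)
Lemma degree_le_oracle (R : realType) (I : finType) (m a : nat) :
  mx_degree_le 1 (oracle_mx R m a : {ffun I -> bool} -> _).
Proof.
move=> k l; rewrite /oracle_mx.
case el: (enum_val l) => [[[i b] w] z].
case: i el => [j|] el.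
  pose e (c : bool) : R[i] := (enum_val k == (Some j, b (+) c, w, z) :> qbasis I m a)%:R.
  have := degree_leM (degree_le_cst I 0 (e true - e false)) (degree_le_var R[i] j).
  move=> /(degree_add (degree_le_cst I 1 (e false))); apply: eq_degree_le => x.
  rewrite mxE el /= /e; case: (x j); first by rewrite mulr1 addrC subrK.
  by rewrite mulr0 addr0.
apply: eq_degree_le (degree_le_cst I 1
  (enum_val k == (None, b (+) false, w, z) :> qbasis I m a)%:R) => x.
by rewrite mxE el.
Qed.

Local Notation "x %:C" := (real_complex _ x) : ring_scope.

Lemma conj_diag_mx_expr (K : comPzRingType) p (U V : 'M[K]_p) (d : 'rV[K]_p) k :
  U *m V = 1%:M -> V *m U = 1%:M ->
  (U *m diag_mx d *m V) ^+ k = U *m diag_mx (\row_i d 0 i ^+ k) *m V.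
Proof.
move=> UV VU; elim: k => [|k IH].
  rewrite expr0 (_ : \row_i _ = const_mx 1); last by apply/rowP => i; rewrite !mxE expr0.
  by rewrite diag_const_mx mulmx1 UV.
rewrite exprSr IH -[LHS]/(_ *m _) !mulmxA -(mulmxA (U *m _)) VU mulmx1.
congr (_ *m _); rewrite -mulmxA; congr (_ *m _); apply/matrixP => i j.
by rewrite mul_diag_mx !mxE exprSr mulrnAr.
Qed.

Lemma convex_sum_le (K : realDomainType) (T : finType) (t0 : T) (l c : T -> K) :
  (forall t, 0 <= c t) -> \sum_t c t = 1 -> exists t, \sum_s l s * c s <= l t.
Proof.
move=> c_ge0 c_sum.
case: (@arg_maxP _ _ _ t0 xpredT l isT) => t _ l_max; exists t.
rewrite -[l t]mulr1 -c_sum mulr_sumr; apply: ler_sum => s _.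
by apply: ler_wpM2r => //; exact: l_max.
Qed.

(** * Spectral decomposition of the acceptance operator *)

Section Witness.
Variables (R : realType) (I : finType) (m : nat) (A : query_algorithm R I m).
Local Notation C := R[i].
Local Notation N := (qdim I m (alg_ancilla A)).
Implicit Types (x : {ffun I -> bool}) (w : 'cV[C]_(2 ^ m)).

Definition initial_mx : 'M[C]_(N, 2 ^ m) :=
  \matrix_(k, u) let: (i, b, u', z) := (enum_val k : qbasis I m (alg_ancilla A)) in
    ([&& i == None, ~~ b & (z == 0%N :> nat)] && (u' == u))%:R.

Definition apply_queries p x (psi : 'M[C]_(N, p)) : 'M[C]_(N, p) :=
  foldl (fun psi U => U *m (oracle_mx R m (alg_ancilla A) x *m psi)) psi (alg_rest A).

Definition final_mx x := apply_queries x (alg_first A *m initial_mx).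

Definition accept_mx x : 'M[C]_(N, 2 ^ m) :=
  \matrix_(k, u) if enum_val k \in alg_accept A then final_mx x k u else 0.

(** The acceptance operator [M(x)]: its quadratic form on witnesses is the acceptance
    probability. *)
Definition gram_mx x : 'M[C]_(2 ^ m) := ((accept_mx x) ^t* *m accept_mx x)%sesqui.

Lemma final_stateE x w : final_state A x w = final_mx x *m w.
Proof.
rewrite /final_state /final_mx /apply_queries.
have -> : initial_state I (alg_ancilla A) w = initial_mx *m w.
  apply/matrixP => k j; rewrite !mxE ord1.
  under eq_bigr => u _ do rewrite mxE.
  case: (enum_val k) => [[[i b] u] z].
  case: ifP => _.
    rewrite (bigD1 u) //= eqxx mul1r big1 ?addr0 // => u' u'u.
    by rewrite eq_sym (negPf u'u) mul0r.
  by rewrite big1 // => u' _; rewrite mul0r.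
rewrite mulmxA; move: (_ *m initial_mx) => P.
by elim: (alg_rest A) P => [|U r IH] P //=; rewrite -IH !mulmxA.
Qed.

(** Only the oracle depends on the input, so each query raises the degree by 1. *)
Lemma degree_le_accept_mx : mx_degree_le (num_queries A) accept_mx.
Proof.
have fD : mx_degree_le (num_queries A) final_mx.
  have foldD (r : seq 'M[C]_N) D (P : {ffun I -> bool} -> 'M[C]_(N, 2 ^ m)) :
      mx_degree_le D P ->
      mx_degree_le (D + size r) (fun x =>
        foldl (fun psi U => U *m (oracle_mx R m (alg_ancilla A) x *m psi)) (P x) r).
    elim: r D P => [|U r IH] D P PD; first by rewrite addn0.
    have -> : (D + size (U :: r) = (0 + (1 + D)) + size r)%N by rewrite /=; lia.
    apply: (IH _ (fun x => U *m (oracle_mx R m (alg_ancilla A) x *m P x))).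
    apply: mx_degree_leM; first exact: mx_degree_le_cst.
    by apply: mx_degree_leM => //; exact: degree_le_oracle.
  apply: (foldD _ 0%N (fun=> alg_first A *m initial_mx)).
  exact: mx_degree_le_cst.
move=> k u; case: (boolP (enum_val k \in alg_accept A)) => kA.
  by apply: eq_degree_le (fD k u) => x; rewrite mxE kA.
by apply: eq_degree_le (degree_le_cst I _ 0) => x; rewrite mxE (negPf kA).
Qed.

Lemma degree_le_trace_gram k :
  degree_le (2 * num_queries A * k) (fun x => complex.Re (\tr (gram_mx x ^+ k))).
Proof.
have gD : mx_degree_le (2 * num_queries A) gram_mx.
  rewrite mul2n -addnn; apply: mx_degree_leM; last exact: degree_le_accept_mx.
  move=> i j.
  apply: eq_degree_le (degree_le_comp (rmorph0 Num.conj) (rmorphD Num.conj)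
    (degree_le_accept_mx j i)) => x.
  by rewrite [RHS]mxE [in RHS]mxE.
have kD : mx_degree_le (2 * num_queries A * k) (fun x => gram_mx x ^+ k).
  elim: k => [|k IH]; first by under eq_fun do rewrite expr0; exact: mx_degree_le_cst.
  by under eq_fun do rewrite exprS; rewrite mulnS; exact: mx_degree_leM.
apply: degree_le_comp => //; first by move=> [a b] [c d].
exact: degree_le_sum.
Qed.


Lemma sqmodE (z : C) : (sqmod z)%:C = z * z^*.
Proof. by rewrite /sqmod add_Re2_Im2 normCK. Qed.

Lemma sqmod_ge0 (z : C) : 0 <= sqmod z.
Proof. by rewrite addr_ge0 ?sqr_ge0. Qed.

Lemma sqnormE d (v : 'cV[C]_d) : (\sum_k sqmod (v k 0))%:C = ((v ^t* *m v) 0 0)%sesqui.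
Proof.
rewrite rmorph_sum mxE; apply: eq_bigr => k _.
by rewrite !mxE mulrC /=; exact: sqmodE.
Qed.

Lemma accept_probE x w : (accept_prob A x w)%:C = ((w ^t* *m gram_mx x *m w) 0 0)%sesqui.
Proof.
have -> : (w ^t* *m gram_mx x *m w = (accept_mx x *m w) ^t* *m (accept_mx x *m w))%sesqui.
  by rewrite /gram_mx trmx_mul map_mxM !mulmxA.
rewrite -sqnormE /accept_prob; congr (_ %:C).
rewrite (reindex _ (onW_bij _ (@enum_val_bij _))) /=.
rewrite big_mkcond /=; apply: eq_bigr => k _.
rewrite enum_valK final_stateE !mxE.
case: ifP => kA.
  by congr sqmod; apply: eq_bigr => u _; rewrite !mxE kA.
rewrite big1 /sqmod ?expr0n ?addr0 // => u _.
by rewrite mxE kA mul0r.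
Qed.

Lemma gram_mx_normal x : gram_mx x \is normalmx.
Proof.
apply/normalmxP; suff -> : ((gram_mx x) ^t* = gram_mx x)%sesqui by [].
by rewrite /gram_mx trmx_mul map_mxM trmxCK.
Qed.

Let P x := spectralmx (gram_mx x).
Definition eigenvector x i : 'cV[C]_(2 ^ m) := ((row i (P x)) ^t*)%sesqui.

Lemma row_mulmx_adjoint p q (B D : 'M[C]_(p, q)) i j :
  ((row i B *m (row j D) ^t* ) 0 0 = (B *m D ^t* ) i j)%sesqui.
Proof. by rewrite !mxE; apply: eq_bigr => k _; rewrite !mxE. Qed.

Lemma spectralK x : ((P x) ^t* *m P x = 1%:M)%sesqui.
Proof.
by rewrite -invmx_unitary ?spectral_unitarymx // mulVmx // spectral_unit.
Qed.

Lemma gram_spectral x :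
  (gram_mx x = (P x) ^t* *m diag_mx (spectral_diag (gram_mx x)) *m P x)%sesqui.
Proof.
rewrite -invmx_unitary ?spectral_unitarymx //.
exact: (orthomx_spectralP (gram_mx_normal x)).
Qed.

Lemma eigenvector_state x i : is_qstate (eigenvector x i).
Proof.
apply: (@complexI R); rewrite sqnormE /eigenvector trmxCK row_mulmx_adjoint.
by rewrite (unitarymxP (spectral_unitarymx _)) mxE eqxx.
Qed.

(** An eigenvector is itself a witness, so soundness bounds its eigenvalue directly. *)
Lemma eigenvalueE x i :
  spectral_diag (gram_mx x) 0 i = (accept_prob A x (eigenvector x i))%:C.
Proof.
have PPt := unitarymxP (spectral_unitarymx (gram_mx x)).
rewrite accept_probE /eigenvector trmxCK -row_mul row_mulmx_adjoint.
rewrite [X in P x *m X]gram_spectral !mulmxA PPt mul1mx -mulmxA PPt mulmx1.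
by rewrite mxE eqxx mulr1n.
Qed.

Lemma trace_gram x k :
  complex.Re (\tr (gram_mx x ^+ k)) =
  \sum_i accept_prob A x (eigenvector x i) ^+ k.
Proof.
suff -> : \tr (gram_mx x ^+ k) = (\sum_i accept_prob A x (eigenvector x i) ^+ k)%:C by [].
have PPt := unitarymxP (spectral_unitarymx (gram_mx x)).
rewrite {1}gram_spectral conj_diag_mx_expr ?spectralK //.
rewrite mxtrace_mulC mulmxA PPt mul1mx mxtrace_diag rmorph_sum.
by apply: eq_bigr => i _; rewrite mxE eigenvalueE rmorphXn.
Qed.

(** The coefficients are the squared moduli of the coordinates of [w] in the eigenbasis. *)
Lemma accept_prob_convex x w : is_qstate w ->
  exists c : 'I_(2 ^ m) -> R, [/\ forall i, 0 <= c i, \sum_i c i = 1 &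
    accept_prob A x w = \sum_i accept_prob A x (eigenvector x i) * c i].
Proof.
move=> w1; exists (fun i => sqmod ((P x *m w) i 0)); split.
- by move=> i; exact: sqmod_ge0.
- apply: (@complexI R); rewrite sqnormE trmx_mul map_mxM -mulmxA.
  by rewrite [_ *m (P x *m w)]mulmxA spectralK mul1mx -sqnormE w1.
apply: (@complexI R); rewrite accept_probE {1}gram_spectral.
have -> : (w ^t* *m ((P x) ^t* *m diag_mx (spectral_diag (gram_mx x)) *m P x) *m w =
    (P x *m w) ^t* *m diag_mx (spectral_diag (gram_mx x)) *m (P x *m w))%sesqui.
  by rewrite trmx_mul map_mxM !mulmxA.
rewrite mul_mx_diag rmorph_sum mxE; apply: eq_bigr => i _ /=.
rewrite [X in X * _ = _]mxE [X in X * _ * _ = _]mxE [X in _ X * _ * _ = _]mxE eigenvalueE.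
rewrite (_ : (_ * sqmod _)%:C = (accept_prob A x (eigenvector x i))%:C *
  (sqmod ((P x *m w) i 0))%:C); last exact: rmorphM.
by rewrite sqmodE; ring.
Qed.

End Witness.

Lemma accept_prob_ge0 (R : realType) (I : finType) (m : nat)
    (A : query_algorithm R I m) x w : 0 <= accept_prob A x w.
Proof. by apply: sumr_ge0 => s _; exact: sqmod_ge0. Qed.

(* Amplification without increasing the witness: the trace of the [k]-th power of
   the acceptance operator. *)
Lemma QMA_trace_polynomial (R : realType) (I : finType) (f : partial_fun I)
    (m q k : nat) :
  has_QMA_protocol R f m q ->
  exists F : {ffun I -> bool} -> R, [/\ degree_le (2 * q * k) F,
    forall x, f x = Some true -> (2%:R / 3%:R) ^+ k <= F x &
    forall x, f x = Some false -> 0 <= F x <= 2%:R ^+ m * (1%:R / 3%:R) ^+ k].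
Proof.
case=> A [A_yes A_no] Aq; exists (fun x => complex.Re (\tr (gram_mx A x ^+ k))).
split.
- apply: degree_leW (degree_le_trace_gram A k).
  by apply: leq_mul => //; apply: leq_mul.
- move=> x /A_yes[w w1 w_ge]; rewrite trace_gram.
  have [c [c_ge0 c_sum cE]] := accept_prob_convex A x w1.
  have m_gt0 : (0 < 2 ^ m)%N by rewrite expn_gt0.
  (* Some eigenvalue is at least the acceptance probability of [w], and its power alone bounds the
     trace from below. *)
  have [i li] := convex_sum_le (Ordinal m_gt0)
    (fun i => accept_prob A x (eigenvector A x i)) c_ge0 c_sum.
  move: li; rewrite -cE => /(le_trans w_ge) li.
  rewrite (bigD1 i) //= ler_wpDr //.
    by apply: sumr_ge0 => j _; rewrite exprn_ge0 ?accept_prob_ge0.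
  by rewrite lerXn2r ?nnegrE ?accept_prob_ge0 // divr_ge0.
- move=> x /A_no l_le; rewrite trace_gram; apply/andP; split.
    by apply: sumr_ge0 => j _; rewrite exprn_ge0 ?accept_prob_ge0.
  apply: le_trans (_ : \sum_(i < 2 ^ m) (1%:R / 3%:R) ^+ k <= _).
    apply: ler_sum => i _; rewrite lerXn2r ?nnegrE ?accept_prob_ge0 //.
    by apply: l_le; exact: eigenvector_state.
  by rewrite sumr_const card_ord -[X in X <= _]mulr_natl natrX.
Qed.

(** * Permutation testing *)

Lemma average_ge (R : numFieldType) (T : finType) (F : T -> R) (a : R) :
  (0 < #|T|)%N -> (forall t, a <= F t) -> a <= average F.
Proof.
move=> T_gt0 aF; rewrite /average ler_pdivlMr ?ltr0n // mulr_natr.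
by rewrite -sumr_const; apply: ler_sum.
Qed.

Lemma average_le (R : numFieldType) (T : finType) (F : T -> R) (a : R) :
  (0 < #|T|)%N -> (forall t, F t <= a) -> average F <= a.
Proof.
move=> T_gt0 aF; rewrite /average ler_pdivrMr ?ltr0n // mulr_natr.
by rewrite -sumr_const; apply: ler_sum.
Qed.

Lemma one_per_row_graph (n : nat) (f : 'I_n -> 'I_n) : one_per_row (graph_input f).
Proof.
apply/forallP => i; rewrite -(cards1 (f i)); apply/eqP/eq_card => j.
by rewrite !inE ffunE eq_sym.
Qed.

Lemma occupied_columns_graph (n : nat) (f : 'I_n -> 'I_n) :
  occupied_columns (graph_input f) = finset (mem (codom f)).
Proof.
apply/setP => j; rewrite !inE; apply/existsP/codomP => -[l].
  by rewrite ffunE /= => /eqP <-; exists l.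
by move=> ->; exists l; rewrite ffunE /=.
Qed.

Lemma PTP_perm (R : realType) (alpha : R) (n : nat) (tau : {perm 'I_n}) :
  PTP n alpha (graph_input tau) = Some true.
Proof.
rewrite /PTP one_per_row_graph /= occupied_columns_graph.
by rewrite cardsE card_codom ?card_ord ?eqxx //; exact: perm_inj.
Qed.

Lemma PTP_small_range (R : realType) (alpha : R) (n N : nat) (le_Nn : (N <= n)%N)
    (tau : {perm 'I_n}) (h : {ffun 'I_n -> 'I_N}) :
  (N < n)%N -> N%:R <= alpha * n%:R ->
  PTP n alpha (graph_input (small_range le_Nn tau h)) = Some false.
Proof.
move=> lt_Nn Na; rewrite /PTP one_per_row_graph /= occupied_columns_graph.
have cN : (#|finset (mem (codom (small_range le_Nn tau h)))| <= N)%N.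
  rewrite -[N in (_ <= N)%N]card_ord.
  rewrite (leq_trans _ (leq_image_card (fun b => tau (widen_ord le_Nn b)) predT)) //.
  apply/subset_leq_card/fintype.subsetP => j; rewrite inE => /codomP[i ->].
  by apply/fintype.imageP; exists (h i).
by rewrite ltn_eqF ?(leq_ltn_trans cN) // ifT // (le_trans _ Na) // ler_nat.
Qed.

(** The positive stand-in [m'] for [m] covers the case [m = 0], and serves as [b] in
    [extrapolation_to_0]. *)
Lemma PTP_tradeoff (R : realType) (alpha : R) : 0 < alpha -> alpha < 1 ->
  exists C n0 : nat, forall n m m' q : nat, (n0 <= n)%N -> (m <= m')%N -> (0 < m')%N ->
    has_QMA_protocol R (PTP n alpha) m q -> (n <= C * q ^ 3 * m')%N.
Proof.
move=> alpha_gt0 alpha_lt1.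
pose G : R := 272%:R * expR 6%:R.
have G_ge0 : 0 <= G by rewrite mulr_ge0 ?ler0n ?expR_ge0.
have [kap0 G_le] : exists kap0 : nat, G <= 2%:R ^+ kap0.
  exists (Num.truncn G).+1; apply: ltW; apply: lt_le_trans (truncnS_gt _) _.
  by rewrite -natrX ler_nat ltnW // ltn_expl.
(* The exponent [k = kap0 m' + 2m'] has to beat the growth [2^(kap0 m')] and the factor [2^m] on
   no-instances together. *)
pose kap := kap0.+2.
have [C C_ge] : exists C : nat, (70 * kap ^ 3)%N%:R / alpha <= C%:R :> R.
  by exists (Num.truncn ((70 * kap ^ 3)%N%:R / alpha)).+1; exact/ltW/truncnS_gt.
have [n0 n0_ge] : exists n0 : nat, 7%:R / alpha <= n0%:R :> R.
  by exists (Num.truncn (7%:R / alpha)).+1; exact/ltW/truncnS_gt.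
exists C, n0 => n m m' q n0n mm' m'_gt0 prot.
have n_gt0 : 0 < n%:R :> R.
  by rewrite (lt_le_trans (y := n0%:R)) ?ler_nat // (lt_le_trans _ n0_ge) ?divr_gt0.
have an_ge0 : 0 <= alpha * n%:R by rewrite mulr_ge0 // ltW.
have [n' [n'_le n'_gt]] : exists n' : nat,
    n'%:R <= alpha * n%:R /\ alpha * n%:R < n'%:R + 1.
  exists (Num.truncn (alpha * n%:R)); apply/andP; rewrite natr1.
  by rewrite truncn_itv.
have n'_ge6 : (6 <= n')%N.
  have : 7%:R <= alpha * n%:R.
    rewrite mulrC -ler_pdivrMr //; apply: le_trans n0_ge _.
    by rewrite ler_nat.
  rewrite -ltnS -(@ltr_nat R) -natr1; lra.
have n'_lt : (n' < n)%N.
  rewrite -(@ltr_nat R); apply: le_lt_trans n'_le _.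
  by rewrite gtr_pMl.
pose k := (kap * m')%N; pose d := (2 * q * k)%N.
(* If this fails, extrapolation to 0 applies and contradicts the gap; if it holds, division by
   [m'^2] gives the claim. *)
suff n'_small : (n' * m' ^ 2 < 2 * (m' ^ 2 + d ^ 2) * (d.*2 + 3))%N.
  have {n'_small} n'_small :
      (n' < 2 * (1 + 4 * q ^ 2 * kap ^ 2) * (4 * q * kap * m' + 3))%N.
    rewrite -(@ltn_pmul2r (m' ^ 2)) ?expn_gt0 ?m'_gt0 //.
    apply: leq_trans n'_small _; apply: eq_leq.
    by rewrite /d /k -mul2n; ring.
  (* For [q = 0] the bound reads [n' < 6], which the choice of [n0] excludes. *)
  have q_gt0 : (0 < q)%N.
    by case: q {prot d} n'_small => //; rewrite exp0n // !(muln0, mul0n); clear -n'_ge6; lia.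
  have n'_le' : (n' < 70 * kap ^ 3 * (q ^ 3 * m'))%N.
    apply: leq_trans n'_small _.
    (* [70 = 2 * 5 * 7], from [1 + 4x <= 5x] and [4x + 3 <= 7x] for [x >= 1]. *)
    have kq : (1 <= q ^ 2 * kap ^ 2)%N by rewrite muln_gt0 !expn_gt0 q_gt0.
    have kqm : (1 <= q * kap * m')%N by rewrite !muln_gt0 q_gt0 m'_gt0.
    apply: leq_trans (_ : 2 * (5 * (q ^ 2 * kap ^ 2)) * (7 * (q * kap * m')) <= _)%N.
      by apply: leq_mul; clear -kq kqm; lia.
    by apply: eq_leq; ring.
  rewrite -(@ler_nat R) -mulnA natrM.
  apply: le_trans (_ : (70 * kap ^ 3)%N%:R / alpha * (q ^ 3 * m')%N%:R <= _); last first.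
    by rewrite ler_wpM2r.
  rewrite mulrAC ler_pdivlMr // -natrM mulrC (le_trans (ltW n'_gt)) //.
  by rewrite natr1 ler_nat.
rewrite ltnNge; apply/negP => n'_big.
have [F [F_deg F_yes F_no]] := QMA_trace_polynomial k prot.
have [Q [sQ QN Q0]] := small_range_polynomial F_deg.
set eps := 2%:R ^+ m * (1%:R / 3%:R) ^+ k in F_no.
have Q_small N : (0 < N <= n')%N -> `|Q.[N%:R^-1]| <= eps.
  move=> /andP[N_gt0 N_le].
  have Nn : (N < n)%N by apply: leq_ltn_trans N_le n'_lt.
  have c_gt0 : (0 < #|{: {perm 'I_n} * {ffun 'I_n -> 'I_N}}|)%N.
    by rewrite card_prod card_Sn card_ffun !card_ord muln_gt0 fact_gt0 expn_gt0 N_gt0.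
  have Na : N%:R <= alpha * n%:R by apply: le_trans n'_le; rewrite ler_nat.
  rewrite (QN _ (ltnW Nn)) // ger0_norm.
    apply: average_le => // -[tau h].
    by have /andP[] := F_no _ (PTP_small_range (ltnW Nn) tau h Nn Na).
  apply: average_ge => // -[tau h].
  by have /andP[] := F_no _ (PTP_small_range (ltnW Nn) tau h Nn Na).
have Q_big : (2%:R / 3%:R) ^+ k <= Q.[0].
  rewrite Q0; apply: average_ge; first by rewrite card_Sn fact_gt0.
  by move=> tau; apply: F_yes; exact: PTP_perm.
have := extrapolation_to_0 m'_gt0 sQ Q_small n'_big.
rewrite -/G => Q_le.
(* Cancelling [3^-k] leaves [2^k <= 2^(kap0 m' + m)], against the choice of [kap]. *)
have : (2%:R / 3%:R) ^+ k <= (2%:R ^+ kap0) ^+ m' * eps.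
  apply: le_trans Q_big _; apply: le_trans (ler_norm _) _; apply: le_trans Q_le _.
  by rewrite ler_wpM2r ?mulr_ge0 ?exprn_ge0 ?divr_ge0 // lerXn2r ?nnegrE // exprn_ge0.
rewrite /eps mulrA div1r exprMn ler_pM2r ?exprn_gt0 ?invr_gt0 //.
rewrite -exprM -exprD ler_eXn2l ?ltr1n // leqNgt => /negP; apply.
rewrite /k /kap !mulSn; move: (kap0 * m')%N => z; clear -mm' m'_gt0; lia.
Qed.

Lemma powR_root_le (R : realType) (x y : R) (k : nat) :
  0 <= x -> 0 <= y -> (0 < k)%N -> x <= y ^+ k -> x `^ (1%:R / k%:R) <= y.
Proof.
move=> x0 y0 k0 xy; have k_gt0 : 0 < k%:R :> R by rewrite ltr0n.
have yE : (y ^+ k) `^ (1%:R / k%:R) = y.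
  by rewrite -powR_mulrn // -powRrM mulrC divfK ?powRr1 // gt_eqF.
by rewrite -[leRHS]yE; apply: ge0_ler_powR; rewrite ?nnegrE ?divr_ge0 ?exprn_ge0.
Qed.

Theorem theorem1p2 (R : realType) (alpha : R)
    (alpha_gt0 : 0 < alpha) (alpha_lt1 : alpha < 1) :
  (exists (c : R) (n0 : nat), 0 < c /\
     forall n m q : nat, (n0 <= n)%N -> (0 < m)%N ->
       has_QMA_protocol R (PTP n alpha) m q ->
       c * (n%:R / m%:R) `^ (1%:R / 3%:R) <= q%:R)
  /\
  (exists (c : R) (n0 : nat), 0 < c /\
     forall n : nat, (n0 <= n)%N ->
       ((c * n%:R `^ (1%:R / 4%:R))%:E <= QMA_complexity R (PTP n alpha))%E).
Proof.
have [C [n0 tradeoff]] := PTP_tradeoff alpha_gt0 alpha_lt1.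
have C_gt0 : 0 < C.+1%:R :> R by [].
(* [C <= (C+1)^3] and [C <= (C+1)^4] let the constant pass through the roots; [n0.+1] ensures
   [n > 0]. *)
split; exists C.+1%:R^-1, n0.+1; rewrite invr_gt0; split=> //.
  move=> n m q n0n m_gt0 /(tradeoff _ _ _ _ (ltnW n0n) (leqnn m) m_gt0) n_le.
  rewrite ler_pdivrMl // powR_root_le ?mulr_ge0 ?divr_ge0 //.
  rewrite ler_pdivrMr ?ltr0n // -natrM -natrX -natrM ler_nat.
  rewrite (leq_trans n_le) // leq_mul2r expnMn leq_mul2r; apply/orP; right.
  by apply/orP; right; rewrite (leq_trans (leqnSn C)) // -{1}[C.+1]expn1 leq_pexp2l.
move=> n n0n; apply: le_ereal_inf_tmp => _ [m [q [prot ->]]].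
rewrite lee_fin.
(* Here [m' = m+1], since [m] may be 0. As [n > 0] forces [q >= 1], [q^3 (m+1) <= (m+q)^4]. *)
have n_le := tradeoff _ _ _ _ (ltnW n0n) (leqnSn m) isT prot.
have q_gt0 : (0 < q)%N.
  by case: q {prot} n_le => //; rewrite exp0n // muln0 mul0n; case: n n0n.
rewrite ler_pdivrMl // powR_root_le ?mulr_ge0 //.
rewrite -natrM -natrX ler_nat (leq_trans n_le) // expnMn -mulnA leq_mul //.
  by rewrite (leq_trans (leqnSn C)) // -{1}[C.+1]expn1 leq_pexp2l.
rewrite [((m + q) ^ 4)%N]expnSr leq_mul // ?leq_exp2r ?leq_addl //.
by lia.
Qed.
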